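(* Let $\rho(f) \in [0,1)$ denote the rotation number of $f: \mathbb{T} \to \mathbb{T}$. (i) If $\rho(f) \not\in \mathbb{Q}$, $f$ is topologically conjugate to the rotation $x \mapsto x + \rho(f) \pmod 1$ on $\mathbb{T}$. In particular $f$ is minimal (all orbits are dense). (ii) If $\rho(f) \in \mathbb{Q}$, write $\rho(f) = p/q$, where, if $\rho(f)>0$, $p,q$ are coprime positive integers, else $p=0,q=1$. There exist two sets $\mathcal{P}^\pm := \bigcup_{i=0}^{q-1} \mathcal{P}_i^\pm$, where the $\mathcal{P}_i^\pm$ are closed intervals. All points in $\mathcal{P}^\pm$ are $q$-periodic and, for all $i \in \mathbb{Z}_q$ and $n \in \mathbb{N}$, $f^n(\mathcal{P}_i^\pm) = \mathcal{P}_{i+pn}^\pm$. All points in $\mathbb{T} \setminus (\mathcal{P}^+ \cup \mathcal{P}^-)$ are non-periodic. Only two possibilities are given: (a) Each $\mathcal{P}_i^\pm$ reduces to a point $x_i^\pm$, ordered according to the orientation of $\mathbb{T}$ as $x_0^- \le x_0^+ \le x_1^- \le x_1^+ \le \cdots \le x_{q-1}^- \le x_{q-1}^+ \le x_0^-$. So $\mathcal{O}^\pm := \{x_0^\pm,\ldots,x_{q-1}^\pm\}$ are two (possibly coinciding) periodic orbits with $f^n(x_i^\pm)=x_{i+pn}^\pm$. For $x\in(x_i^-,x_i^+)$: $f^n(x)\in(x_{i+pn}^-,x_{i+pn}^+)$, $\lim_{n\to+\infty}f^{nq}(x)=x_i^+$, $\lim_{n\to-\infty}f^{nq}(x)=x_i^-$.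 For $x\in(x_i^+,x_{i+1}^-)$: $f^n(x)\in(x_{i+pn}^+,x_{i+1+pn}^-)$, $\lim_{n\to+\infty}f^{nq}(x)=x_i^+$, $\lim_{n\to-\infty}f^{nq}(x)=x_{i+1}^-$. Hence $\mathcal{O}^+$, resp. $\mathcal{O}^-$, is the global attractor, resp. repellor. (b) All $\mathcal{P}_i^\pm$ are non-degenerate intervals with $\mathcal{P}_i^+=\mathcal{P}_i^-=:[x_i^L,x_i^R]$, and $x_0^L < x_0^R \le x_1^L < x_1^R \le \cdots \le x_{q-1}^L < x_{q-1}^R \le x_0^L$, where $x_i^R<x_{i+1}^L$ holds for some $i$ iff it holds for all $i$. (1) If $x_i^R<x_{i+1}^L$ for all $i$, then for $x\in(x_i^R,x_{i+1}^L)$: $f^n(x)\in(x_{i+pn}^R,x_{i+1+pn}^L)$, $\lim_{n\to+\infty}f^{nq}(x)=x_i^R$, $\lim_{n\to-\infty}f^{nq}(x)=x_{i+1}^L$; so $\{x_i^R\}$ and $\{x_i^L\}$ are the unique (not global) attractor and repellor. (2) If $x_i^R=x_{i+1}^L$ for all $i$, all orbits are periodic. If moreover the right side of the table contains no segment (equivalently $b$ is strictly concave), case (b) cannot occur.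
   Context: Setting: an internal-wave billiard (unit-speed point particle in a planar table, reflected so that the angles of incident and reflected velocities with the vertical are equal) in a table $D$ of height $1/2$ with horizontal bases, a vertical left side, and right side the graph of a piecewise $C^1$, strictly decreasing, concave function (possibly plus a vertical segment at its lower end). The dynamics is unfolded to a unit-speed linear flow of direction $\theta\in(\alpha_M,\pi/2)$ on a 4-fold copy $\hat D$ of $D$ whose upper boundary is the graph of an even, piecewise $C^1$, concave function $b:[-1/2,1/2]\to\mathbb{R}^+$ non-increasing on $[0,1/2]$ (lower boundary its mirror image), opposite boundary points identified; $\alpha_M=\arctan b'(-1/2)$. $f$ is the first-return map of this flow to a horizontal cross-section $\Sigma$ of length 1, identified with the circle $\mathbb{T}=\mathbb{R}/\mathbb{Z}$; $f$ is an orientation-preserving homeomorphism. The rotation number is $\rho(f)=\lim_{n\to\infty}(F^n(x)-x)/n \bmod 1$ for a lift $F:\mathbb{R}\to\mathbb{R}$ of $f$. $\mathbb{Z}_q=\mathbb{Z}/q\mathbb{Z}$ denotes cyclic indices (sums of indices taken mod $q$). *)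

(* Defs.v *)
From Stdlib Require Import Reals Lra Lia ClassicalEpsilon.
From Coquelicot Require Import Coquelicot.
Open Scope R_scope.

Fixpoint itn (F : R -> R) (n : nat) (x : R) : R :=
  match n with O => x | S m => F (itn F m x) end.

Definition Finv (F : R -> R) (y : R) : R :=
  epsilon (inhabits 0) (fun x => F x = y).

Definition itz (F : R -> R) (n : Z) (x : R) : R :=
  match n with
  | Z0 => x
  | Zpos p => itn F (Pos.to_nat p) x
  | Zneg p => itn (Finv F) (Pos.to_nat p) x
  end.

(* The circle T = R/Z, points represented by real numbers              *)
Definition eqm (x y : R) : Prop := exists k : Z, x - y = IZR k.
Definition dT (x y : R) : R := Rmin (frac_part (x - y)) (1 - frac_part (x - y)).
(* closed arc of T lifted to [a,c] (a <= c <= a+1), and open arc (a,c) *)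
Definition inArc (a c x : R) : Prop := exists k : Z, a <= x + IZR k <= c.
Definition inOArc (a c x : R) : Prop := exists k : Z, a < x + IZR k < c.
Definition Tmap (g : R -> R) : Prop := forall x y, eqm x y -> eqm (g x) (g y).
Definition Tcont (g : R -> R) : Prop :=
  forall x eps, 0 < eps -> exists d, 0 < d /\
    forall y, dT x y < d -> dT (g x) (g y) < eps.
Definition Thomeo (h : R -> R) : Prop :=
  Tmap h /\ Tcont h /\
  exists k : R -> R, Tmap k /\ Tcont k /\
    (forall x, eqm (k (h x)) x) /\ (forall x, eqm (h (k x)) x).

Definition rotnum (F : R -> R) : R :=
  frac_part (real (Lim_seq (fun n => (itn F n 0 - 0) / INR n))).

Definition Ih (x : R) : Prop := - / 2 <= x <= / 2.

Definition cont_in (P : R -> Prop) (g : R -> R) (x : R) : Prop :=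
  forall eps, 0 < eps -> exists d, 0 < d /\
    forall y, P y -> Rabs (y - x) < d -> Rabs (g y - g x) < eps.

Definition nonneg_on (b : R -> R) := forall x, Ih x -> 0 <= b x.
Definition even_on (b : R -> R) := forall x, Ih x -> b (- x) = b x.
Definition concave_on (b : R -> R) :=
  forall x y t, Ih x -> Ih y -> 0 <= t <= 1 ->
    t * b x + (1 - t) * b y <= b (t * x + (1 - t) * y).
Definition strictly_concave_on (b : R -> R) :=
  forall x y t, Ih x -> Ih y -> x <> y -> 0 < t < 1 ->
    t * b x + (1 - t) * b y < b (t * x + (1 - t) * y).
Definition nonincr_right (b : R -> R) :=
  forall x y, 0 <= x -> x <= y -> y <= / 2 -> b y <= b x.
Definition cont_on (b : R -> R) := forall x, Ih x -> cont_in Ih b x.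
Definition pw_C1 (b : R -> R) : Prop :=
  exists (n : nat) (a : nat -> R),
    (0 < n)%nat /\ a 0%nat = - / 2 /\ a n = / 2 /\
    (forall k, (k < n)%nat -> a k < a (S k)) /\
    (forall k, (k < n)%nat -> exists g : R -> R,
       (forall x, a k <= x <= a (S k) ->
          cont_in (fun y => a k <= y <= a (S k)) g x) /\
       (forall x, a k < x < a (S k) -> is_derive b x (g x))).

Definition admissible (b : R -> R) : Prop :=
  nonneg_on b /\ even_on b /\ concave_on b /\ nonincr_right b /\
  cont_on b /\ pw_C1 b.

Definition rderiv (b : R -> R) (x l : R) : Prop :=
  forall eps, 0 < eps -> exists d, 0 < d /\
    forall h, 0 < h < d -> Rabs ((b (x + h) - b x) / h - l) < eps.

(* reduce to [-1/2,1/2) and 1-periodic extension of b (left/right sides of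
   D^ identified by horizontal translation) *)
Definition red (u : R) : R := u - IZR (Int_part (u + / 2)).
Definition bper (b : R -> R) (u : R) : R := b (red u).

(* starting at (x,0) in direction (cos th, sin th), the orbit hits the upper
   boundary at abscissa u with (u - x) tan th = b(u) *)
Definition hit (b : R -> R) (th x : R) : R :=
  epsilon (inhabits 0) (fun u => (u - x) * tan th = bper b u).
(* after the identification (u, b u) ~ (u, - b u), the orbit returns to the
   section Sigma = {y = 0} at abscissa 2u - x: this is the lift F of f *)
Definition retF (b : R -> R) (th : R) (x : R) : R := 2 * hit b th x - x.

Definition nextv (v : nat -> R) (q j : nat) : R :=
  if Nat.ltb (S j) q then v (S j) else v 0%nat + 1.

(* case (a): P_i^- = {xm i}, P_i^+ = {xp i} *)
Definition caseA (F : R -> R) (p q : nat) (am cm ap cp : nat -> R) : Prop :=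
  let xm := am in let xp := ap in
  (forall i, (i < q)%nat -> am i = cm i /\ ap i = cp i) /\
  (forall i, (i < q)%nat -> xm i <= xp i) /\
  (forall i, (S i < q)%nat -> xp i <= xm (S i)) /\
  xp (q - 1)%nat <= xm 0%nat + 1 /\
  (forall i n, (i < q)%nat ->
     eqm (itn F n (xm i)) (xm ((i + p * n) mod q)%nat) /\
     eqm (itn F n (xp i)) (xp ((i + p * n) mod q)%nat)) /\
  (forall i x, (i < q)%nat -> inOArc (xm i) (xp i) x ->
     (forall n, inOArc (xm ((i + p * n) mod q)%nat) (xp ((i + p * n) mod q)%nat)
                       (itn F n x)) /\
     is_lim_seq (fun n => dT (itn F (n * q) x) (xp i)) 0 /\
     is_lim_seq (fun n => dT (itz F (- Z.of_nat (n * q)) x) (xm i)) 0) /\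
  (forall i x, (i < q)%nat -> inOArc (xp i) (nextv xm q i) x ->
     (forall n, inOArc (xp ((i + p * n) mod q)%nat)
                       (nextv xm q ((i + p * n) mod q)%nat) (itn F n x)) /\
     is_lim_seq (fun n => dT (itn F (n * q) x) (xp i)) 0 /\
     is_lim_seq (fun n => dT (itz F (- Z.of_nat (n * q)) x) (nextv xm q i)) 0).

(* case (b): P_i^+ = P_i^- = [xL i, xR i], non-degenerate *)
Definition caseB (F : R -> R) (p q : nat) (am cm ap cp : nat -> R) : Prop :=
  let xL := am in let xR := cm in
  (forall i, (i < q)%nat -> am i = ap i /\ cm i = cp i) /\
  (forall i, (i < q)%nat -> xL i < xR i) /\
  (forall i, (S i < q)%nat -> xR i <= xL (S i)) /\
  xR (q - 1)%nat <= xL 0%nat + 1 /\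
  ((exists i, (i < q)%nat /\ xR i < nextv xL q i) <->
   (forall i, (i < q)%nat -> xR i < nextv xL q i)) /\
  ((forall i, (i < q)%nat -> xR i < nextv xL q i) ->
   forall i x, (i < q)%nat -> inOArc (xR i) (nextv xL q i) x ->
     (forall n, inOArc (xR ((i + p * n) mod q)%nat)
                       (nextv xL q ((i + p * n) mod q)%nat) (itn F n x)) /\
     is_lim_seq (fun n => dT (itn F (n * q) x) (xR i)) 0 /\
     is_lim_seq (fun n => dT (itz F (- Z.of_nat (n * q)) x) (nextv xL q i)) 0) /\
  ((forall i, (i < q)%nat -> xR i = nextv xL q i) ->
   forall x, exists n, (0 < n)%nat /\ eqm (itn F n x) x).

(* Main.v *)
(** With [c = b / tan th] extended periodically, the return map lifts to
    [F = (id + c) o (id - c)^-1], where [id - c] is convex on [[-1/2, 1/2]]: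
    so [F] is a circle homeomorphism which is concave on a fundamental domain
    [[a, a+1]], with a single convex kink.

    Rational case [P/q]: let [x0 <= a <= y0] be the fixed points of
    [F^q - P] closest to the kink, and [T] the passage to the next point of a
    periodic orbit.  No iterate [F^j], [j < q], of [(a, T x0)] meets the kink,
    so [F^q] is concave on [[a, T x0]]; having fixed endpoints on [[y0, T x0]],
    it is there the identity or above it.  The gap [(x0, y0)] contains no
    periodic point and [T] carries this picture around the circle.

    Irrational case: let [I] be an interval collapsed by the semiconjugacy to
    the rotation, and [q] a closest return time at which [F^-q I] lies to the
    right of [I].  By concavity each [F^j] expands [I] more than [F^-q I],
    except for the one [j < q] for which the kink lies in between.
    Hence [|F^q I| |F^-q I| >= const |I|^2], whereas both factors on the left
    are small since they lie close to the ends of a maximal collapsed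
    interval. *)

From Stdlib Require Import Reals Lra Lia Psatz ZArith Classical ClassicalEpsilon.
From Coquelicot Require Import Coquelicot.
(* [Defs] comes last because [ZArith] also exports a constant named [eqm]. *)
Require Import Defs.
Open Scope R_scope.

(** The boundary may have corners, so [F] need not be differentiable. Chord slopes replace
    derivatives throughout, and in Denjoy's argument the monotonicity of slopes on one cell replaces
    the bounded variation of the logarithm of the derivative.

    The kink comes from the identified vertical sides: there the periodic extension of [b] turns
    from slope [- dM] back to slope [dM]. The point [a] is where a trajectory hitting that corner
    leaves the section. Since [F] is [2 (id - c)^-1 - id], it inherits the concavity of the hitting
    abscissa.

    The condition [dM < tan th] makes [c] Lipschitz with constant [k = dM / tan th < 1]. Hence [F]
    is bi-Lipschitz with constant [(1 + k) / (1 - k)]. This constant is paid only at the exceptional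
    iterate, once for each of the two intervals, and so appears squared.

    In both cases the visits to the kink are counted by order alone: through the cyclic order of a
    periodic orbit when the rotation number is rational, through the order of the values of the
    semiconjugacy when it is not. *)

(** * Lifts of circle homeomorphisms and their iterates *)

(** Surjectivity stands for continuity: an increasing surjection of the line is continuous, and the
    arguments below use preimages of given values rather than limits. *)
Record circle_lift (F : R -> R) : Prop := {
  lift_lt : forall x y, x < y -> F x < F y;
  lift_1 : forall x, F (x + 1) = F x + 1;
  lift_surj : forall y, exists x, F x = y }.

Lemma lift_le F : circle_lift F -> forall x y, x <= y -> F x <= F y.
Proof.
intros HF x y [H | ->]; [left; now apply (lift_lt F) | right; reflexivity].
Qed.

Lemma lift_lt_inv F : circle_lift F -> forall x y, F x < F y -> x < y.
Proof.
intros HF x y H. destruct (Rlt_le_dec x y) as [h | h]; trivial.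
apply (lift_le F HF) in h. lra.
Qed.

Lemma lift_le_inv F : circle_lift F -> forall x y, F x <= F y -> x <= y.
Proof.
intros HF x y H. destruct (Rle_lt_dec x y) as [h | h]; trivial.
apply (lift_lt F HF) in h. lra.
Qed.

Lemma lift_inj F : circle_lift F -> forall x y, F x = F y -> x = y.
Proof.
intros HF x y H. apply Rle_antisym; apply (lift_le_inv F HF); lra.
Qed.

Lemma degree1_nat (f : R -> R) : (forall x, f (x + 1) = f x + 1) ->
  forall n x, f (x + INR n) = f x + INR n.
Proof.
intros H n; induction n as [|n IH]; intros x.
- simpl. now rewrite !Rplus_0_r.
- rewrite S_INR, <- Rplus_assoc, H, IH. ring.
Qed.

Lemma degree1_IZR (f : R -> R) : (forall x, f (x + 1) = f x + 1) ->
  forall k x, f (x + IZR k) = f x + IZR k.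
Proof.
intros H k x. destruct (Z_le_gt_dec 0 k) as [h | h].
- rewrite <- (Z2Nat.id k) by lia. rewrite <- INR_IZR_INZ. now apply degree1_nat.
- assert (E : IZR k = - INR (Z.to_nat (- k))).
  { rewrite INR_IZR_INZ, Z2Nat.id by lia. rewrite opp_IZR. ring. }
  rewrite E. set (n := Z.to_nat (- k)).
  generalize (degree1_nat f H n (x + - INR n)).
  replace (x + - INR n + INR n) with x by ring. lra.
Qed.

Lemma lift_nat F : circle_lift F -> forall n x, F (x + INR n) = F x + INR n.
Proof. intros HF. exact (degree1_nat F (lift_1 F HF)). Qed.

Lemma lift_IZR F : circle_lift F -> forall k x, F (x + IZR k) = F x + IZR k.
Proof. intros HF. exact (degree1_IZR F (lift_1 F HF)). Qed.

Lemma lift_Finv_r F : circle_lift F -> forall y, F (Finv F y) = y.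
Proof.
intros HF y. unfold Finv. apply epsilon_spec. apply (lift_surj F HF).
Qed.

Lemma lift_Finv_l F : circle_lift F -> forall x, Finv F (F x) = x.
Proof.
intros HF x. apply (lift_inj F HF). now apply lift_Finv_r.
Qed.

Lemma lift_Finv F : circle_lift F -> circle_lift (Finv F).
Proof.
intros HF; split.
- intros x y h. apply (lift_lt_inv F HF). now rewrite !(lift_Finv_r F HF).
- intros x. apply (lift_inj F HF).
  now rewrite (lift_1 F HF), !(lift_Finv_r F HF).
- intros y. exists (F y). now apply lift_Finv_l.
Qed.

Lemma lift_id : circle_lift (fun x => x).
Proof. split; intros; trivial. now exists y. Qed.

Lemma lift_comp F G : circle_lift F -> circle_lift G ->
  circle_lift (fun x => F (G x)).
Proof.
intros HF HG; split.
- intros x y h. now apply (lift_lt F HF), (lift_lt G HG).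
- intros x. now rewrite (lift_1 G HG), (lift_1 F HF).
- intros y. destruct (lift_surj F HF y) as [z <-].
  destruct (lift_surj G HG z) as [x <-]. now exists x.
Qed.

Lemma lift_itn F : circle_lift F -> forall n, circle_lift (itn F n).
Proof.
intros HF n; induction n as [|n IH].
- apply lift_id.
- exact (lift_comp F (itn F n) HF IH).
Qed.

Lemma lift_shift F : circle_lift F ->
  forall k, circle_lift (fun x => F x + IZR k).
Proof.
intros HF k; split.
- intros x y h. apply (lift_lt F HF) in h. lra.
- intros x. rewrite (lift_1 F HF). ring.
- intros y. destruct (lift_surj F HF (y - IZR k)) as [x E]. exists x. lra.
Qed.

(** Conjugation by the reflection [x -> - x] yields the mirror image of each statement about
    increasing orbits; it changes the sign of the rotation number. *)
Lemma lift_opp F : circle_lift F -> circle_lift (fun x => - F (- x)).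
Proof.
intros HF; split.
- intros x y h. apply Ropp_lt_contravar, (lift_lt F HF). lra.
- intros x. generalize (lift_1 F HF (- (x + 1))).
  replace (- (x + 1) + 1) with (- x) by ring. lra.
- intros y. destruct (lift_surj F HF (- y)) as [x E]. exists (- x).
  rewrite Ropp_involutive. lra.
Qed.

Lemma itn_add F n m x : itn F (n + m) x = itn F n (itn F m x).
Proof. induction n as [|n IH]; simpl; trivial. now rewrite IH. Qed.

Lemma itn_mul F n m x : itn F (n * m) x = itn (itn F m) n x.
Proof. induction n as [|n IH]; simpl; trivial. now rewrite itn_add, IH. Qed.

Lemma itn_comm F G : (forall x, F (G x) = G (F x)) ->
  forall n x, itn F n (G x) = G (itn F n x).
Proof. intros H n x; induction n as [|n IH]; simpl; trivial. now rewrite IH, H. Qed.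

Lemma itn_S F n x : itn F (S n) x = itn F n (F x).
Proof. symmetry. now apply itn_comm. Qed.

Lemma itn_opp F n x : itn (fun x => - F (- x)) n x = - itn F n (- x).
Proof.
induction n as [|n IH]; simpl; [ring |]. now rewrite IH, Ropp_involutive.
Qed.

Lemma itn_shift F : circle_lift F ->
  forall k n x, itn (fun x => F x + IZR k) n x = itn F n x + INR n * IZR k.
Proof.
intros HF k n x. induction n as [|n IH]; [simpl; ring |].
rewrite S_INR. simpl itn. rewrite IH.
replace (INR n * IZR k) with (IZR (Z.of_nat n * k))
  by (rewrite mult_IZR, <- INR_IZR_INZ; reflexivity).
rewrite (lift_IZR F HF), mult_IZR, <- INR_IZR_INZ. ring.
Qed.

Lemma itn_gt F : circle_lift F ->
  forall n x, (0 < n)%nat -> x < F x -> x < itn F n x.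
Proof.
intros HF n x Hn h. induction n as [|n IH]; [lia |].
destruct n as [|n]; [exact h |].
assert (x < itn F (S n) x) by (apply IH; lia).
apply Rlt_trans with (F x); trivial. now apply (lift_lt F HF).
Qed.

Lemma itn_lt F : circle_lift F ->
  forall n x, (0 < n)%nat -> F x < x -> itn F n x < x.
Proof.
intros HF n x Hn h. induction n as [|n IH]; [lia |].
destruct n as [|n]; [exact h |].
assert (itn F (S n) x < x) by (apply IH; lia).
apply Rlt_trans with (F x); trivial. now apply (lift_lt F HF).
Qed.

Lemma itn_Finv_r F : circle_lift F -> forall n x, itn F n (itn (Finv F) n x) = x.
Proof.
intros HF n; induction n as [|n IH]; intros x; trivial.
rewrite itn_S. simpl. now rewrite (lift_Finv_r F HF), IH.
Qed.

Lemma itn_fix F x : F x = x -> forall n, itn F n x = x.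
Proof. intros H n; induction n as [|n IH]; simpl; trivial. now rewrite IH. Qed.

(** * Monotone orbits *)

(** The limit [s] is the supremum of the orbit. If [s < F s], then [Finv F s < s], so some iterate
    passes [Finv F s] and the next one passes [s]. *)
Lemma orbit_up_bounded F u v : circle_lift F -> u < F u ->
  (forall n, itn F n u <= v) ->
  exists s, u < s <= v /\ F s = s /\
    (forall n, u <= itn F n u < s) /\
    forall eps, 0 < eps -> exists N, forall n, (N <= n)%nat -> s - eps < itn F n u.
Proof.
intros HF Hu bd.
assert (mono : forall n, itn F n u < itn F (S n) u).
{ intros n. rewrite itn_S. now apply (lift_lt _ (lift_itn F HF n)). }
assert (mono' : forall n k, itn F n u <= itn F (k + n) u).
{ intros n k; induction k as [|k IH]; simpl; [lra |].
  generalize (mono (k + n)%nat). simpl. lra. }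
destruct (completeness (fun t => exists n, t = itn F n u)) as [s [ub lub]].
{ exists v. intros t [n ->]. apply bd. }
{ exists u. now exists 0%nat. }
assert (below : forall n, itn F n u < s).
{ intros n. apply Rlt_le_trans with (itn F (S n) u); trivial. apply ub. now exists (S n). }
assert (near : forall t, t < s -> exists n, t < itn F n u).
{ intros t h. apply NNPP. intros H. apply (Rlt_not_le _ _ h). apply lub.
  intros r [n ->]. apply Rnot_lt_le. intros h'. apply H. now exists n. }
exists s. split; [| split; [| split]].
- split; [apply (below 0%nat) | apply lub; intros t [n ->]; apply bd].
- apply Rle_antisym.
  + apply Rnot_lt_le. intros h.
    destruct (near (Finv F s)) as [n Hn].
    { apply (lift_lt_inv F HF). now rewrite (lift_Finv_r F HF). }
    apply (lift_lt F HF) in Hn. rewrite (lift_Finv_r F HF) in Hn.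
    generalize (below (S n)). simpl. lra.
  + apply lub. intros t [n ->]. left. apply Rlt_trans with (1 := mono n).
    simpl. apply (lift_lt F HF), below.
- intros n. split; trivial. generalize (mono' 0%nat n).
  rewrite Nat.add_0_r. simpl. lra.
- intros eps He. destruct (near (s - eps)) as [N HN]; [lra |].
  exists N. intros n Hn. generalize (mono' N (n - N)%nat).
  replace (n - N + N)%nat with n by lia. lra.
Qed.

Lemma orbit_up F u v : circle_lift F -> u < F u -> u < v -> F v <= v ->
  exists s, u < s <= v /\ F s = s /\
    (forall n, u <= itn F n u < s) /\
    forall eps, 0 < eps -> exists N, forall n, (N <= n)%nat -> s - eps < itn F n u.
Proof.
intros HF Hu Huv Hv. apply orbit_up_bounded; trivial.
induction n as [|n IH]; simpl; [lra |]. apply (lift_le F HF) in IH. lra.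
Qed.

Lemma orbit_down F u v : circle_lift F -> F u < u -> v < u -> v <= F v ->
  exists s, v <= s < u /\ F s = s /\
    (forall n, s < itn F n u <= u) /\
    forall eps, 0 < eps -> exists N, forall n, (N <= n)%nat -> itn F n u < s + eps.
Proof.
intros HF Hu Huv Hv.
destruct (orbit_up (fun x => - F (- x)) (- u) (- v)) as (s & h1 & h2 & h3 & h4);
  rewrite ?Ropp_involutive; try lra.
{ now apply lift_opp. }
exists (- s). split; [lra | split; [lra | split]].
- intros n. specialize (h3 n). rewrite itn_opp, Ropp_involutive in h3. lra.
- intros eps He. destruct (h4 eps He) as [N HN]. exists N. intros n Hn.
  specialize (HN n Hn). rewrite itn_opp, Ropp_involutive in HN. lra.
Qed.

Lemma last_fixed_point F a z : circle_lift F -> F z = z -> z <= a ->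
  exists s, F s = s /\ s <= a /\ forall t, F t = t -> t <= a -> t <= s.
Proof.
intros HF Hz Hza.
destruct (completeness (fun t => F t = t /\ t <= a)) as [s [ub lub]].
{ exists a. now intros t [_ h]. }
{ now exists z. }
exists s. split; [| split].
- apply Rle_antisym; apply Rnot_lt_le; intros h.
  + assert (h' : Finv F s < s).
    { apply (lift_lt_inv F HF). now rewrite (lift_Finv_r F HF). }
    apply (Rlt_not_le _ _ h'), lub. intros t [Ht Hta].
    apply (lift_le_inv F HF). rewrite (lift_Finv_r F HF), Ht. now apply ub.
  + apply (Rlt_not_le _ _ h), lub. intros t [Ht Hta].
    rewrite <- Ht. apply (lift_le F HF). now apply ub.
- apply lub. now intros t [_ h].
- intros t Ht Hta. now apply ub.
Qed.

Lemma first_fixed_point F a z : circle_lift F -> F z = z -> a <= z ->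
  exists s, F s = s /\ a <= s /\ forall t, F t = t -> a <= t -> s <= t.
Proof.
intros HF Hz Hza.
destruct (last_fixed_point (fun x => - F (- x)) (- a) (- z)) as (s & h1 & h2 & h3);
  rewrite ?Ropp_involutive; try lra.
{ now apply lift_opp. }
exists (- s). split; [lra | split; [lra |]].
intros t Ht Hta. specialize (h3 (- t)). rewrite Ropp_involutive in h3. lra.
Qed.

(** If [u] moves up and [v] moves down, a monotone orbit converges to a fixed point between them:
    that of [u] under [F] when [u < v], that of [v] under the inverse when [v < u]. *)
Lemma no_fixed_point_sign F y z : circle_lift F ->
  (forall x, y < x < z -> F x <> x) ->
  (forall x, y < x < z -> x < F x) \/ (forall x, y < x < z -> F x < x).
Proof.
intros HF H.
destruct (classic (exists u, y < u < z /\ u < F u)) as [[u [Hu1 Hu2]] | HN].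
- left. intros v Hv. destruct (Rtotal_order v (F v)) as [h | [h | h]]; trivial;
    exfalso.
  + now apply (H v Hv).
  + destruct (Rtotal_order u v) as [h' | [h' | h']].
    * destruct (orbit_up F u v HF) as (s & h1 & h2 & _); try lra.
      apply (H s); lra.
    * subst; lra.
    * destruct (orbit_up (Finv F) v u (lift_Finv F HF)) as (s & h1 & h2 & _); trivial.
      -- apply (lift_lt_inv F HF). now rewrite (lift_Finv_r F HF).
      -- left. apply (lift_lt_inv F HF). now rewrite (lift_Finv_r F HF).
      -- apply (H s); [lra |]. rewrite <- h2 at 1. now apply lift_Finv_r.
- right. intros v Hv. destruct (Rtotal_order v (F v)) as [h | [h | h]]; trivial;
    exfalso.
  + apply HN. now exists v.
  + now apply (H v Hv).
Qed.

(** * Rotation number *)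

(** The rotation number of the lift, not reduced modulo 1. Of the bound 2, one unit is the error
    along the orbit of 0 and one comes from comparing [x] with an integer. *)
Definition has_rotation (F : R -> R) (al : R) : Prop :=
  forall n x, Rabs (itn F n x - x - INR n * al) <= 2.

(** The number [al] is a Dedekind cut: the supremum of the fractions [m / n] with [m <= F^n 0].
    Comparing two fractions of denominators [n] and [N] on the common iterate [F^(n N) 0] shows that
    those with [F^N 0 <= m] are upper bounds. *)
Lemma rotation_exists F : circle_lift F -> exists al, has_rotation F al.
Proof.
intros HF.
assert (hup : forall n m k, IZR m <= itn F n 0 -> INR k * IZR m <= itn F (k * n) 0).
{ intros n m k h. rewrite itn_mul. induction k as [|k IH]; [simpl; lra |].
  rewrite S_INR. simpl itn. apply (lift_le _ (lift_itn F HF n)) in IH.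
  apply Rle_trans with (2 := IH).
  replace (INR k * IZR m) with (0 + IZR (Z.of_nat k * m))
    by (rewrite mult_IZR, <- INR_IZR_INZ; ring).
  rewrite (lift_IZR _ (lift_itn F HF n)), mult_IZR, <- INR_IZR_INZ. lra. }
assert (hdn : forall n m k, itn F n 0 <= IZR m -> itn F (k * n) 0 <= INR k * IZR m).
{ intros n m k h. rewrite itn_mul. induction k as [|k IH]; [simpl; lra |].
  rewrite S_INR. simpl itn. apply (lift_le _ (lift_itn F HF n)) in IH.
  apply Rle_trans with (1 := IH).
  replace (INR k * IZR m) with (0 + IZR (Z.of_nat k * m))
    by (rewrite mult_IZR, <- INR_IZR_INZ; ring).
  rewrite (lift_IZR _ (lift_itn F HF n)), mult_IZR, <- INR_IZR_INZ. lra. }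
set (E := fun t => exists n m, (0 < n)%nat /\ IZR m <= itn F n 0 /\ INR n * t = IZR m).
assert (comp : forall n t N M, (0 < n)%nat -> IZR M <= itn F n 0 -> INR n * t = IZR M ->
   forall m, (0 < N)%nat -> itn F N 0 <= IZR m -> INR N * t <= IZR m).
{ intros n t N M Hn h1 h2 m HN h3.
  apply (hup _ _ N) in h1. apply (hdn _ _ n) in h3.
  rewrite Nat.mul_comm in h1. assert (0 < INR n) by now apply lt_0_INR.
  apply Rmult_le_reg_l with (INR n); trivial.
  replace (INR n * (INR N * t)) with (INR N * (INR n * t)) by ring. rewrite h2. lra. }
destruct (archimed (F 0)) as [ar1 ar2]. set (M := up (F 0)) in *.
destruct (completeness E) as [al [ub lub]].
{ exists (IZR (M)). intros t (n & m & Hn & h1 & h2).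
  generalize (comp n t 1%nat m Hn h1 h2 M ltac:(lia)). simpl itn.
  simpl INR. lra. }
{ exists (IZR (M - 1)). exists 1%nat, (M - 1)%Z.
  split; [lia |]. rewrite minus_IZR. simpl. lra. }
exists al.
assert (H0 : forall n, Rabs (itn F n 0 - INR n * al) <= 1).
{ intros n. destruct n as [|n]; [simpl; rewrite Rabs_pos_eq; lra |].
  destruct (archimed (itn F (S n) 0)) as [b1 b2].
  set (m := up (itn F (S n) 0)) in *.
  assert (Hpos : 0 < INR (S n)) by (apply lt_0_INR; lia).
  assert (A1 : IZR (m - 1) / INR (S n) <= al).
  { apply ub. exists (S n), (m - 1)%Z. split; [lia |]. rewrite minus_IZR. split; [lra |].
    field. lra. }
  assert (A2 : al <= IZR m / INR (S n)).
  { apply lub. intros t (n' & m' & Hn & h1 & h2).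
    apply (Rmult_le_reg_l (INR (S n))); trivial.
    replace (INR (S n) * (IZR m / INR (S n))) with (IZR m) by (field; lra).
    apply (comp n' t (S n) m'); trivial; [lia | lra]. }
  apply (Rmult_le_compat_l (INR (S n))) in A1, A2; try lra.
  replace (INR (S n) * (IZR m / INR (S n))) with (IZR m) in A2 by (field; lra).
  replace (INR (S n) * (IZR (m - 1) / INR (S n))) with (IZR m - 1) in A1
    by (rewrite minus_IZR; field; lra).
  apply Rabs_le. lra. }
intros n x.
destruct (archimed x) as [c1 c2]. set (m := up x) in *.
assert (L1 : itn F n (0 + IZR (m - 1)) <= itn F n x)
  by (apply (lift_le _ (lift_itn F HF n)); rewrite minus_IZR; lra).
assert (L2 : itn F n x <= itn F n (0 + IZR m))
  by (apply (lift_le _ (lift_itn F HF n)); lra).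
rewrite (lift_IZR _ (lift_itn F HF n)) in L1, L2. rewrite minus_IZR in L1.
generalize (proj1 (Rabs_le_between _ _) (H0 n)). intros. apply Rabs_le. lra.
Qed.

Lemma rotnum_frac F al : has_rotation F al -> rotnum F = frac_part al.
Proof.
intros H. unfold rotnum. f_equal.
assert (Z : forall c, is_lim_seq (fun n => al + c * / INR (S n)) al).
{ intros c. replace (Finite al) with (Finite (al + c * 0)) by (f_equal; ring).
  apply is_lim_seq_plus'; [apply is_lim_seq_const |].
  apply is_lim_seq_mult'; [apply is_lim_seq_const |].
  apply (is_lim_seq_incr_1 (fun n => / INR n)).
  replace (Finite 0) with (Rbar_inv p_infty) by reflexivity.
  apply is_lim_seq_inv; [apply is_lim_seq_INR | discriminate]. }
assert (L : is_lim_seq (fun n => (itn F n 0 - 0) / INR n) al).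
{ apply is_lim_seq_incr_1.
  apply is_lim_seq_le_le with
    (u := fun n => al - 2 * / INR (S n)) (w := fun n => al + 2 * / INR (S n)).
  - intros n. specialize (H (S n) 0).
    apply (proj1 (Rabs_le_between _ _)) in H.
    assert (Hpos : 0 < INR (S n)) by (apply lt_0_INR; lia).
    split; apply (Rmult_le_reg_l (INR (S n))); trivial.
    + replace (INR (S n) * (al - 2 * / INR (S n))) with (INR (S n) * al - 2) by (field; lra).
      replace (INR (S n) * ((itn F (S n) 0 - 0) / INR (S n))) with (itn F (S n) 0)
        by (field; lra). lra.
    + replace (INR (S n) * (al + 2 * / INR (S n))) with (INR (S n) * al + 2) by (field; lra).
      replace (INR (S n) * ((itn F (S n) 0 - 0) / INR (S n))) with (itn F (S n) 0)
        by (field; lra). lra.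
  - apply (is_lim_seq_ext (fun n => al + -2 * / INR (S n))); [intros n; ring | apply Z].
  - apply Z. }
apply is_lim_seq_unique in L. now rewrite L.
Qed.

(* Iterating [F^n x >= x + m] shows [k n al >= k m - 2] for all [k]. *)
Lemma rotation_ge F al n m x : circle_lift F -> has_rotation F al ->
  x + IZR m <= itn F n x -> IZR m <= INR n * al.
Proof.
intros HF H h.
assert (hup : forall k, x + INR k * IZR m <= itn F (k * n) x).
{ intros k. rewrite itn_mul. induction k as [|k IH]; [simpl; lra |].
  rewrite S_INR. simpl itn. apply (lift_le _ (lift_itn F HF n)) in IH.
  apply Rle_trans with (2 := IH).
  replace (INR k * IZR m) with (IZR (Z.of_nat k * m))
    by (rewrite mult_IZR, <- INR_IZR_INZ; ring).
  rewrite (lift_IZR _ (lift_itn F HF n)), mult_IZR, <- INR_IZR_INZ. lra. }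
apply Rnot_lt_le. intros h'.
destruct (INR_archimed (IZR m - INR n * al) 2) as [k Hk]; [lra |].
specialize (hup k). specialize (H (k * n)%nat x).
apply (proj1 (Rabs_le_between _ _)) in H. rewrite mult_INR in H. nra.
Qed.

Lemma rotation_le F al n m x : circle_lift F -> has_rotation F al ->
  itn F n x <= x + IZR m -> INR n * al <= IZR m.
Proof.
intros HF H h.
assert (H' : has_rotation (fun x => - F (- x)) (- al)).
{ intros k y. specialize (H k (- y)). rewrite itn_opp, <- Rabs_Ropp.
  replace (- (- itn F k (- y) - y - INR k * - al))
    with (itn F k (- y) - - y - INR k * al) by ring. exact H. }
generalize (rotation_ge _ _ n (- m)%Z (- x) (lift_opp F HF) H').
rewrite itn_opp, opp_IZR, Ropp_involutive. lra.
Qed.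

(** If [Ph = F^q - P] moves 0 up, its orbit either stays below 1 and converges to a fixed point, or
    reaches 1 after some [n] steps, which forces [n q al >= n P + 1]. *)
Lemma periodic_point_exists F al q P : circle_lift F -> has_rotation F al ->
  INR q * al = IZR P -> exists z, itn F q z = z + IZR P.
Proof.
assert (half : forall F al P, circle_lift F -> has_rotation F al ->
  INR q * al = IZR P -> 0 + IZR P < itn F q 0 -> exists z, itn F q z = z + IZR P).
{ clear. intros F al P HF Hr E h.
  set (Ph := fun x => itn F q x + IZR (- P)).
  assert (HPh : circle_lift Ph) by (apply lift_shift, lift_itn; trivial).
  destruct (classic (forall n, itn Ph n 0 <= 1)) as [bd | nb].
  - destruct (orbit_up_bounded Ph 0 1 HPh) as (s & _ & h2 & _); trivial;
      unfold Ph in *; rewrite opp_IZR in *; [lra |]. exists s. lra.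
  - apply not_all_ex_not in nb. destruct nb as [n Hn]. exfalso. apply Hn. left.
    apply Rnot_le_lt. intros h'. unfold Ph in h'.
    rewrite (itn_shift _ (lift_itn F HF q)), <- itn_mul, opp_IZR in h'.
    assert (A : IZR (Z.of_nat n * P + 1) <= INR (n * q) * al).
    { apply (rotation_ge F al (n * q) _ 0 HF Hr).
      rewrite plus_IZR, mult_IZR, <- INR_IZR_INZ. lra. }
    rewrite plus_IZR, mult_IZR, <- INR_IZR_INZ, mult_INR, Rmult_assoc, E in A. lra. }
intros HF Hr E. destruct (Rtotal_order (0 + IZR P) (itn F q 0)) as [h | [h | h]].
- now apply (half F al).
- exists 0. now symmetry.
- destruct (half (fun x => - F (- x)) (- al) (- P)%Z) as [z Hz].
  + now apply lift_opp.
  + intros k y. specialize (Hr k (- y)). rewrite itn_opp, <- Rabs_Ropp.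
    replace (- (- itn F k (- y) - y - INR k * - al))
      with (itn F k (- y) - - y - INR k * al) by ring. exact Hr.
  + rewrite opp_IZR. lra.
  + rewrite itn_opp, opp_IZR, Ropp_0. lra.
  + exists (- z). rewrite itn_opp, opp_IZR in Hz. lra.
Qed.

(** * The circle metric *)

Lemma frac_part_bounds t : 0 <= frac_part t < 1.
Proof. destruct (base_fp t). lra. Qed.

Lemma dT_nonneg x y : 0 <= dT x y.
Proof.
unfold dT. generalize (frac_part_bounds (x - y)). intros.
apply Rmin_glb; lra.
Qed.

(** Together with [dT_attained], this identifies [dT x y] as the distance from [x - y] to the
    integers. *)
Lemma dT_le x y k : dT x y <= Rabs (x - y - IZR k).
Proof.
generalize (frac_part_bounds (x - y)). unfold dT. intros H.
set (f := frac_part (x - y)) in *.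
assert (E : x - y - IZR k = IZR (Int_part (x - y) - k) + f)
  by (unfold f, frac_part; rewrite minus_IZR; ring).
rewrite E. destruct (Z_le_gt_dec 0 (Int_part (x - y) - k)) as [h | h].
- apply Rle_trans with f; [apply Rmin_l |]. apply IZR_le in h.
  rewrite Rabs_pos_eq; lra.
- apply Rle_trans with (1 - f); [apply Rmin_r |].
  assert (h' : (Int_part (x - y) - k <= -1)%Z) by lia. apply IZR_le in h'.
  rewrite Rabs_left1; lra.
Qed.

Lemma dT_attained x y : exists k, Rabs (x - y - IZR k) = dT x y.
Proof.
generalize (frac_part_bounds (x - y)). unfold dT. intros H.
assert (E : x - y = IZR (Int_part (x - y)) + frac_part (x - y))
  by (unfold frac_part; ring).
set (f := frac_part (x - y)) in *. set (m := Int_part (x - y)) in *.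
destruct (Rle_lt_dec f (1 - f)) as [h | h].
- exists m. rewrite Rmin_left by trivial. rewrite E, Rabs_pos_eq; lra.
- exists (m + 1)%Z. rewrite Rmin_right by lra. rewrite E, plus_IZR, Rabs_left1; lra.
Qed.

(** The orbit of [u] under [g^q - P] increases to a fixed point, which can only be [v]. The shift
    [k] is there because a point of an arc has only some integer translate between the lifted
    endpoints; [P] is a signed integer so that the inverse map is covered too. *)
Lemma lift_cv_up g q P u v k : circle_lift g -> u < v ->
  itn g q v = v + IZR P -> u + IZR P < itn g q u ->
  (forall x, u < x < v -> itn g q x <> x + IZR P) ->
  is_lim_seq (fun n => dT (itn g (n * q) (u - IZR k)) v) 0.
Proof.
intros Hg Huv Hv Hu Hno.
set (Ph := fun x => itn g q x + IZR (- P)).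
assert (HPh : circle_lift Ph) by (apply lift_shift, lift_itn; trivial).
destruct (orbit_up Ph u v HPh) as (s & h1 & h2 & h3 & h4); trivial;
  unfold Ph in *; rewrite ?opp_IZR in *; try lra.
assert (s = v).
{ apply NNPP. intros h. apply (Hno s); lra. }
subst s. apply is_lim_seq_spec. intros eps.
destruct (h4 eps (cond_pos eps)) as [N HN]. exists N. intros n Hn.
specialize (HN n Hn). specialize (h3 n).
(* After [n q] steps the lift has gained [n P]; together with the initial shift [- k] this is the
   integer to remove. *)
rewrite Rminus_0_r, (Rabs_pos_eq (dT _ _)) by apply dT_nonneg.
apply Rle_lt_trans with (1 := dT_le _ _ (Z.of_nat n * P - k)%Z).
rewrite <- opp_IZR in *. rewrite (itn_shift _ (lift_itn g Hg q)) in h3, HN.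
rewrite itn_mul. replace (u - IZR k) with (u + IZR (- k)) by (rewrite opp_IZR; ring).
rewrite (lift_IZR _ (lift_itn _ (lift_itn g Hg q) n)).
rewrite minus_IZR, mult_IZR, <- INR_IZR_INZ. rewrite opp_IZR in *.
apply Rabs_def1; lra.
Qed.

Lemma lift_cv_down g q P u v k : circle_lift g -> v < u ->
  itn g q v = v + IZR P -> itn g q u < u + IZR P ->
  (forall x, v < x < u -> itn g q x <> x + IZR P) ->
  is_lim_seq (fun n => dT (itn g (n * q) (u - IZR k)) v) 0.
Proof.
intros Hg Huv Hv Hu Hno.
set (Ph := fun x => itn g q x + IZR (- P)).
assert (HPh : circle_lift Ph) by (apply lift_shift, lift_itn; trivial).
destruct (orbit_down Ph u v HPh) as (s & h1 & h2 & h3 & h4); trivial;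
  unfold Ph in *; rewrite ?opp_IZR in *; try lra.
assert (s = v).
{ apply NNPP. intros h. apply (Hno s); lra. }
subst s. apply is_lim_seq_spec. intros eps.
destruct (h4 eps (cond_pos eps)) as [N HN]. exists N. intros n Hn.
specialize (HN n Hn). specialize (h3 n).
rewrite Rminus_0_r, (Rabs_pos_eq (dT _ _)) by apply dT_nonneg.
apply Rle_lt_trans with (1 := dT_le _ _ (Z.of_nat n * P - k)%Z).
rewrite <- opp_IZR in *. rewrite (itn_shift _ (lift_itn g Hg q)) in h3, HN.
rewrite itn_mul. replace (u - IZR k) with (u + IZR (- k)) by (rewrite opp_IZR; ring).
rewrite (lift_IZR _ (lift_itn _ (lift_itn g Hg q) n)).
rewrite minus_IZR, mult_IZR, <- INR_IZR_INZ. rewrite opp_IZR in *.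
apply Rabs_def1; lra.
Qed.

(** * Concavity away from the kink *)

Definition concave_btw (f : R -> R) (l r : R) : Prop :=
  forall x y t, l <= x <= r -> l <= y <= r -> 0 <= t <= 1 ->
    t * f x + (1 - t) * f y <= f (t * x + (1 - t) * y).

Definition strictly_concave_btw (f : R -> R) (l r : R) : Prop :=
  forall x y t, l <= x <= r -> l <= y <= r -> x <> y -> 0 < t < 1 ->
    t * f x + (1 - t) * f y < f (t * x + (1 - t) * y).

Lemma convex_comb_bounds l r x y t : l <= x <= r -> l <= y <= r -> 0 <= t <= 1 ->
  l <= t * x + (1 - t) * y <= r.
Proof. intros; split; nra. Qed.

Lemma concave_slopes f l r : concave_btw f l r ->
  forall x y z, l <= x -> x < y -> y < z -> z <= r ->
  (f z - f y) * (y - x) <= (f y - f x) * (z - y).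
Proof.
intros H x y z h1 h2 h3 h4.
generalize (H x z ((z - y) / (z - x)) ltac:(lra) ltac:(lra)).
replace ((z - y) / (z - x) * x + (1 - (z - y) / (z - x)) * z) with y by (field; lra).
intros K.
assert (t1 : 0 <= (z - y) / (z - x)) by (apply Rdiv_le_0_compat; lra).
assert (t2 : (z - y) / (z - x) <= 1).
{ apply Rmult_le_reg_r with (z - x); [lra |].
  replace ((z - y) / (z - x) * (z - x)) with (z - y) by (field; lra). lra. }
specialize (K (conj t1 t2)).
apply Rmult_le_compat_r with (r := z - x) in K; [| lra].
replace (((z - y) / (z - x) * f x + (1 - (z - y) / (z - x)) * f z) * (z - x))
  with ((z - y) * f x + (y - x) * f z) in K by (field; lra).
lra.
Qed.

(** The chord over [[y, w]] lies between the other two in slope; denominators are cleared. *)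
Lemma concave_slopes_disjoint f l r : concave_btw f l r ->
  forall x y z w, l <= x -> x < y -> y <= z -> z < w -> w <= r ->
  (f w - f z) * (y - x) <= (f y - f x) * (w - z).
Proof.
intros H x y z w h1 h2 h3 h4 h5.
generalize (concave_slopes f l r H x y w h1 h2 ltac:(lra) h5). intros K1.
destruct h3 as [h3 | <-]; trivial.
generalize (concave_slopes f l r H y z w ltac:(lra) h3 h4 h5). intros K2.
apply Rmult_le_reg_r with (w - y); [lra |].
assert (K3 : (f w - f z) * (w - y) <= (f w - f y) * (w - z)) by nra.
apply Rle_trans with ((f w - f y) * (w - z) * (y - x)); nra.
Qed.

Lemma floor_interval a u v : u <= v -> (forall m, ~ (u < a + IZR m < v)) ->
  exists m, a + IZR m <= u /\ v <= a + IZR m + 1.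
Proof.
intros huv H.
destruct (archimed (u - a)) as [h1 h2]. set (m := up (u - a)) in *.
exists (m - 1)%Z. rewrite minus_IZR. split; [lra |].
apply Rnot_lt_le. intros h. apply (H m). lra.
Qed.

Lemma concave_shift F a m : circle_lift F -> concave_btw F a (a + 1) ->
  concave_btw F (a + IZR m) (a + IZR m + 1).
Proof.
intros HF H x y t hx hy ht.
generalize (H (x + IZR (- m)) (y + IZR (- m)) t).
replace (t * (x + IZR (- m)) + (1 - t) * (y + IZR (- m)))
  with (t * x + (1 - t) * y + IZR (- m)) by ring.
rewrite !(lift_IZR F HF), !opp_IZR. intros K. specialize (K ltac:(lra) ltac:(lra) ht).
lra.
Qed.

Lemma strictly_concave_shift F a m : circle_lift F ->
  strictly_concave_btw F a (a + 1) ->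
  strictly_concave_btw F (a + IZR m) (a + IZR m + 1).
Proof.
intros HF H x y t hx hy hxy ht.
generalize (H (x + IZR (- m)) (y + IZR (- m)) t).
replace (t * (x + IZR (- m)) + (1 - t) * (y + IZR (- m)))
  with (t * x + (1 - t) * y + IZR (- m)) by ring.
rewrite !(lift_IZR F HF), !opp_IZR. intros K.
specialize (K ltac:(lra) ltac:(lra) ltac:(lra) ht). lra.
Qed.

(** A composite of increasing concave maps is concave, and each image of [[l, r]] stays in one cell
    [[a + m, a + m + 1]] as long as no translate of the kink [a] is interior to it. *)
Lemma itn_concave F a n l r : circle_lift F -> concave_btw F a (a + 1) -> l <= r ->
  (forall j m, (j < n)%nat -> ~ (itn F j l < a + IZR m < itn F j r)) ->
  concave_btw (itn F n) l r.
Proof.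
intros HF Hc hlr. induction n as [|n IH]; intros H x y t hx hy ht.
{ simpl. lra. }
assert (IH' : concave_btw (itn F n) l r) by (apply IH; intros; apply H; lia).
assert (HFn := lift_itn F HF n).
destruct (floor_interval a (itn F n l) (itn F n r)) as [m [h1 h2]].
{ now apply (lift_le _ HFn). }
{ intros m. apply H. lia. }
assert (B : forall z, l <= z <= r -> a + IZR m <= itn F n z <= a + IZR m + 1).
{ intros z [hz1 hz2]. apply (lift_le _ HFn) in hz1, hz2. lra. }
simpl itn. apply Rle_trans with (2 := lift_le F HF _ _ (IH' x y t hx hy ht)).
apply (concave_shift F a m HF Hc); auto.
Qed.

(** The strictness comes from the last application of [F] alone; the earlier iterates only have to
    keep the two points distinct. *)
Lemma itn_strictly_concave F a n l r : circle_lift F -> concave_btw F a (a + 1) ->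
  strictly_concave_btw F a (a + 1) -> l <= r -> (0 < n)%nat ->
  (forall j m, (j < n)%nat -> ~ (itn F j l < a + IZR m < itn F j r)) ->
  strictly_concave_btw (itn F n) l r.
Proof.
intros HF Hc Hs hlr Hn. destruct n as [|n]; [lia |].
intros H x y t hx hy hxy ht.
assert (IH' : concave_btw (itn F n) l r).
{ apply (itn_concave F a); trivial. intros; apply H; lia. }
assert (HFn := lift_itn F HF n).
destruct (floor_interval a (itn F n l) (itn F n r)) as [m [h1 h2]].
{ now apply (lift_le _ HFn). }
{ intros m. apply H. lia. }
assert (B : forall z, l <= z <= r -> a + IZR m <= itn F n z <= a + IZR m + 1).
{ intros z [hz1 hz2]. apply (lift_le _ HFn) in hz1, hz2. lra. }
simpl itn. apply Rlt_le_trans with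
  (2 := lift_le F HF _ _ (IH' x y t hx hy ltac:(lra))).
apply (strictly_concave_shift F a m HF Hs); auto.
intros E. apply hxy. now apply (lift_inj _ HFn).
Qed.

(** * Rational rotation number: the combinatorics of periodic orbits *)

Definition return_map (F : R -> R) (P q : nat) (x : R) : R :=
  itn F q x + IZR (- Z.of_nat P).

(* On periodic points with rotation number [P / q] and [r P + s q = 1], this
   map is the passage to the next point of the orbit. *)
Definition next_map (F : R -> R) (r : nat) (s : Z) (x : R) : R :=
  itn F r x + IZR s.

Section RationalRotation.

Variables (F : R -> R) (P q r : nat) (s : Z).
Hypothesis HF : circle_lift F.
Hypothesis Hq : (0 < q)%nat.
Hypothesis bezout : (Z.of_nat r * Z.of_nat P + s * Z.of_nat q = 1)%Z.

Local Notation Ph := (return_map F P q).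
Local Notation T := (next_map F r s).
Local Notation Per z := (return_map F P q z%R = z%R).

Lemma return_lift : circle_lift Ph.
Proof. apply lift_shift, lift_itn, HF. Qed.

Lemma next_lift : circle_lift T.
Proof. apply lift_shift, lift_itn, HF. Qed.

Lemma next_F x : T (F x) = F (T x).
Proof.
unfold next_map. rewrite (lift_IZR F HF). f_equal. now apply itn_comm.
Qed.

Lemma next_return x : T (Ph x) = Ph (T x).
Proof.
unfold return_map. rewrite (lift_IZR T next_lift). f_equal.
symmetry. apply itn_comm. intros; symmetry; apply next_F.
Qed.

Lemma itn_next_return n x : itn T n (Ph x) = Ph (itn T n x).
Proof. apply itn_comm, next_return. Qed.

Lemma return_per z : Per z <-> itn F q z = z + INR P.
Proof. unfold return_map. rewrite opp_IZR, <- INR_IZR_INZ. split; lra. Qed.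

Lemma per_itn_next n z : Per z -> Per (itn T n z).
Proof. intros H. now rewrite <- itn_next_return, H. Qed.

Lemma per_next z : Per z -> Per (T z).
Proof. exact (per_itn_next 1 z). Qed.

Lemma per_F z : Per z -> Per (F z).
Proof.
intros H. unfold return_map. rewrite (itn_comm F F) by trivial.
rewrite <- (lift_IZR F HF). now f_equal.
Qed.

Lemma per_itn_F n z : Per z -> Per (itn F n z).
Proof. intros H; induction n as [|n IH]; trivial. now apply per_F. Qed.

Lemma per_shift k z : Per z -> Per (z + IZR k).
Proof. intros H. now rewrite (lift_IZR _ return_lift), H. Qed.

Lemma per_itn_q n z : Per z -> itn F (n * q) z = z + INR n * INR P.
Proof.
intros H. apply return_per in H. rewrite itn_mul. induction n as [|n IH].
- simpl. ring.
- rewrite S_INR. simpl itn. rewrite IH, <- mult_INR.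
  rewrite (lift_nat _ (lift_itn F HF q)), H, mult_INR. ring.
Qed.

Lemma itn_next n x : itn T n x = itn F (n * r) x + INR n * IZR s.
Proof. rewrite itn_mul. apply itn_shift, lift_itn, HF. Qed.

(** One turn takes [q] steps: [F^(r q)] adds [r P] to a periodic point, and [r P + s q = 1]. *)
Lemma next_q z : Per z -> itn T q z = z + 1.
Proof.
intros H. rewrite itn_next, Nat.mul_comm, per_itn_q by trivial.
rewrite !INR_IZR_INZ, Rplus_assoc, <- !mult_IZR, <- plus_IZR.
rewrite (Z.mul_comm _ s), bezout. reflexivity.
Qed.

Lemma next_gt z : Per z -> z < T z.
Proof.
intros H. generalize (next_q z H). intros E.
destruct (Rtotal_order z (T z)) as [h | [h | h]]; trivial.
- rewrite itn_fix in E by (symmetry; trivial). lra.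
- apply (itn_lt T next_lift q) in h; trivial. lra.
Qed.

Lemma next_mono z i j : Per z -> (i <= j)%nat -> itn T i z <= itn T j z.
Proof.
intros H h. induction h as [|j h IH]; [lra |].
simpl. generalize (next_gt _ (per_itn_next j z H)). lra.
Qed.

Lemma next_le_1 z : Per z -> T z <= z + 1.
Proof.
intros H. rewrite <- (next_q z H). apply (next_mono z 1 q H). lia.
Qed.

(** By the Bezout relation, [r P = 1 - s q], so [T^P] is [F] up to whole periods. *)
Lemma next_P z : Per z -> itn T P z = F z.
Proof.
intros H. rewrite itn_next. destruct (Z_le_gt_dec s 0) as [h | h].
- assert (E : (P * r = Z.to_nat (- s) * q + 1)%nat).
  { apply Nat2Z.inj. rewrite Nat2Z.inj_add, !Nat2Z.inj_mul, Z2Nat.id by lia.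
    simpl Z.of_nat. lia. }
  rewrite E, itn_add. simpl itn at 2. rewrite per_itn_q by now apply per_F.
  rewrite (INR_IZR_INZ (Z.to_nat _)), Z2Nat.id by lia. rewrite opp_IZR. ring.
(* As [r P] is nonnegative, a positive [s] forces [s = q = 1] and [r P = 0]. *)
- assert (E1 : (P * r = 0)%nat) by nia. assert (E2 : s = 1%Z) by nia.
  assert (E3 : q = 1%nat) by nia. rewrite E1, E2. simpl itn.
  apply return_per in H. rewrite E3 in H. simpl in H. rewrite H. ring.
Qed.

Lemma itn_F_next n i z : Per z -> itn F n (itn T i z) = itn T (i + P * n) z.
Proof.
intros H. induction n as [|n IH].
- simpl. f_equal. lia.
- simpl itn at 1. rewrite IH, <- next_P by now apply per_itn_next.
  rewrite <- itn_add. f_equal. lia.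
Qed.

Lemma next_mod N z : Per z ->
  itn T N z = itn T (N mod q) z + IZR (Z.of_nat (N / q)).
Proof.
intros H. rewrite (Nat.div_mod_eq N q) at 1. rewrite Nat.add_comm, itn_add.
assert (E : forall k, itn T (q * k) z = z + INR k).
{ intros k. rewrite Nat.mul_comm, itn_mul. induction k as [|k IH]; [simpl; ring |].
  rewrite S_INR. simpl itn. rewrite IH.
  rewrite (lift_nat _ (lift_itn T next_lift q)), next_q by trivial. ring. }
rewrite E, (lift_nat _ (lift_itn T next_lift _)), INR_IZR_INZ. reflexivity.
Qed.

(** Since [F = T^P] on periodic points, every translate of an orbit point is [T^i w + K] with
    [0 <= i < q], and the points [T^i w] increase from [w] to [w + 1]. *)
Lemma no_orbit_between w l k : Per w -> ~ (w < itn F l w + IZR k < T w).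
Proof.
intros H. generalize (itn_F_next l 0 w H). simpl itn. intros ->.
simpl plus. rewrite next_mod, Rplus_assoc, <- plus_IZR by trivial.
set (K := (_ + k)%Z). assert (hi := Nat.mod_upper_bound (P * l) q ltac:(lia)).
set (i := ((P * l) mod q)%nat) in *.
assert (L0 := next_mono w 0 i H ltac:(lia)). simpl itn in L0.
assert (L1 := next_mono w i q H ltac:(lia)). rewrite next_q in L1 by trivial.
assert (L2 := next_le_1 w H). intros [h1 h2].
destruct (Z_lt_le_dec K 0) as [hK | hK].
{ assert (IZR K <= -1) by (apply IZR_le; lia). lra. }
destruct (Z_lt_le_dec 0 K) as [hK' | hK'].
{ assert (1 <= IZR K) by (apply IZR_le; lia). lra. }
replace K with 0%Z in * by lia.
destruct i as [|i].
- simpl itn in h1. lra.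
- assert (L3 := next_mono w 1 (S i) H ltac:(lia)). simpl itn in L3, h2. lra.
Qed.

(** The [q] intervals from [T^i z] to [T^(i+1) z] tile [[z, z + 1)]. *)
Lemma orbit_locate z x : Per z ->
  exists i k, (i < q)%nat /\ itn T i z <= x + IZR k < itn T (S i) z.
Proof.
intros H. destruct (archimed (x - z)) as [h1 h2]. set (m := up (x - z)) in *.
assert (A : forall t n, z <= t < itn T n z ->
  exists i, (i < n)%nat /\ itn T i z <= t < itn T (S i) z).
{ intros t n; induction n as [|n IH]; intros [k1 k2]; [simpl in k2; lra |].
  destruct (Rle_lt_dec (itn T n z) t) as [h | h].
  - exists n. split; [lia | lra].
  - destruct IH as [i [hi1 hi2]]; [lra |]. exists i. split; [lia | trivial]. }
destruct (A (x + IZR (1 - m)) q) as [i [hi1 hi2]].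
{ rewrite next_q by trivial. rewrite minus_IZR. lra. }
exists i, (1 - m)%Z. now split.
Qed.

Lemma itn_next_nextv z i : Per z -> (i < q)%nat ->
  nextv (fun j => itn T j z) q i = itn T i (T z).
Proof.
intros H hi. rewrite <- itn_S. unfold nextv. destruct (Nat.ltb_spec (S i) q) as [h | h]; trivial.
replace (S i) with q by lia. now rewrite next_q.
Qed.

(* The shift [k] does not depend on [z], so that arcs between periodic points
   are carried along. *)
Lemma itn_F_next_mod p n i : (P mod q = p mod q)%nat ->
  exists k, forall z, Per z ->
    itn F n (itn T i z) = itn T ((i + p * n) mod q) z + IZR k.
Proof.
intros Hp. exists (Z.of_nat ((i + P * n) / q)). intros z H.
rewrite itn_F_next, next_mod by trivial.
replace ((i + P * n) mod q)%nat with ((i + p * n) mod q)%nat; trivial.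
rewrite (Nat.Div0.add_mod i (p * n)), (Nat.Div0.mul_mod p), <- Hp.
now rewrite <- (Nat.Div0.mul_mod P), <- Nat.Div0.add_mod.
Qed.

End RationalRotation.

(** * Heteroclinic orbits between neighbouring periodic points *)

Lemma itn_Finv_lt g n u c : circle_lift g ->
  u + IZR c < itn g n u -> itn (Finv g) n u < u + IZR (- c).
Proof.
intros Hg h. apply (lift_lt_inv _ (lift_itn g Hg n)).
rewrite itn_Finv_r, (lift_IZR _ (lift_itn g Hg n)), opp_IZR by trivial. lra.
Qed.

Lemma itn_Finv_gt g n u c : circle_lift g ->
  itn g n u < u + IZR c -> u + IZR (- c) < itn (Finv g) n u.
Proof.
intros Hg h. apply (lift_lt_inv _ (lift_itn g Hg n)).
rewrite itn_Finv_r, (lift_IZR _ (lift_itn g Hg n)), opp_IZR by trivial. lra.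
Qed.

Lemma itn_Finv_eq g n u c : circle_lift g ->
  itn g n u = u + IZR c -> itn (Finv g) n u = u + IZR (- c).
Proof.
intros Hg h. apply (lift_inj _ (lift_itn g Hg n)).
rewrite itn_Finv_r, (lift_IZR _ (lift_itn g Hg n)), opp_IZR by trivial. lra.
Qed.

Lemma itz_opp_nat F n x : itz F (- Z.of_nat n) x = itn (Finv F) n x.
Proof.
destruct n as [|n]; [reflexivity |]. cbn [Z.of_nat Z.opp itz].
now rewrite SuccNat2Pos.id_succ.
Qed.

(** Backward time is forward time for [Finv F], whose [q]-th iterate translates the endpoints by
    [- P] and pushes the interior points down. *)
Lemma heteroclinic_up F q P u v x : circle_lift F ->
  itn F q u = u + IZR P -> itn F q v = v + IZR P ->
  (forall t, u < t < v -> t + IZR P < itn F q t) -> inOArc u v x ->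
  is_lim_seq (fun n => dT (itn F (n * q) x) v) 0 /\
  is_lim_seq (fun n => dT (itz F (- Z.of_nat (n * q)) x) u) 0.
Proof.
intros HF Hu Hv H [k Hx]. replace x with ((x + IZR k) - IZR k) by ring.
set (x' := x + IZR k) in *. clearbody x'. split.
- apply (lift_cv_up F q P); trivial; [lra | apply H; lra |].
  intros t ht E. specialize (H t). lra.
- eapply is_lim_seq_ext; [intros n; symmetry; now rewrite itz_opp_nat |].
  apply (lift_cv_down (Finv F) q (- P)); [now apply lift_Finv | lra | | |].
  + now apply itn_Finv_eq.
  + apply itn_Finv_lt; trivial. now apply H.
  + intros t ht E. generalize (itn_Finv_lt F q t P HF (H t ltac:(lra))). lra.
Qed.

Lemma heteroclinic_down F q P u v x : circle_lift F ->
  itn F q u = u + IZR P -> itn F q v = v + IZR P ->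
  (forall t, u < t < v -> itn F q t < t + IZR P) -> inOArc u v x ->
  is_lim_seq (fun n => dT (itn F (n * q) x) u) 0 /\
  is_lim_seq (fun n => dT (itz F (- Z.of_nat (n * q)) x) v) 0.
Proof.
intros HF Hu Hv H [k Hx]. replace x with ((x + IZR k) - IZR k) by ring.
set (x' := x + IZR k) in *. clearbody x'. split.
- apply (lift_cv_down F q P); trivial; [lra | apply H; lra |].
  intros t ht E. specialize (H t). lra.
- eapply is_lim_seq_ext; [intros n; symmetry; now rewrite itz_opp_nat |].
  apply (lift_cv_up (Finv F) q (- P)); [now apply lift_Finv | lra | | |].
  + now apply itn_Finv_eq.
  + apply itn_Finv_gt; trivial. now apply H.
  + intros t ht E. generalize (itn_Finv_gt F q t P HF (H t ltac:(lra))). lra.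
Qed.

(** * The dichotomy for rational rotation number *)

(** Here [strict] stands for strict concavity of the boundary. As [p] enters only through indices
    modulo [q], it may differ from the numerator [P] of the unreduced rotation number by a multiple
    of [q]. *)
Definition rational_picture (F : R -> R) (p q : nat) (strict : Prop) : Prop :=
  exists am cm ap cp : nat -> R,
    (forall i, (i < q)%nat ->
       am i <= cm i <= am i + 1 /\ ap i <= cp i <= ap i + 1) /\
    (forall i x, (i < q)%nat ->
       (inArc (am i) (cm i) x \/ inArc (ap i) (cp i) x) -> eqm (itn F q x) x) /\
    (forall i n y, (i < q)%nat ->
       (inArc (am ((i + p * n) mod q)%nat) (cm ((i + p * n) mod q)%nat) y <->
          exists x, inArc (am i) (cm i) x /\ eqm (itn F n x) y) /\
       (inArc (ap ((i + p * n) mod q)%nat) (cp ((i + p * n) mod q)%nat) y <->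
          exists x, inArc (ap i) (cp i) x /\ eqm (itn F n x) y)) /\
    (forall x, (forall i, (i < q)%nat ->
                  ~ inArc (am i) (cm i) x /\ ~ inArc (ap i) (cp i) x) ->
       forall n, (0 < n)%nat -> ~ eqm (itn F n x) x) /\
    (caseA F p q am cm ap cp \/ caseB F p q am cm ap cp) /\
    (strict -> caseA F p q am cm ap cp).

Section RationalPicture.

Variables (F : R -> R) (p P q r : nat) (s : Z) (a al : R) (strict : Prop).
Hypothesis HF : circle_lift F.
Hypothesis Hq : (0 < q)%nat.
Hypothesis bezout : (Z.of_nat r * Z.of_nat P + s * Z.of_nat q = 1)%Z.
Hypothesis Hp : (P mod q = p mod q)%nat.
Hypothesis Hrot : has_rotation F al.
Hypothesis Hal : INR q * al = INR P.
Hypothesis Hconc : concave_btw F a (a + 1).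
Hypothesis Hstrict : strict -> strictly_concave_btw F a (a + 1).

Local Notation Ph := (return_map F P q).
Local Notation T := (next_map F r s).
Local Notation Per z := (return_map F P q z%R = z%R).

Let HPh : circle_lift Ph := return_lift F P q HF.
Let HT : circle_lift T := next_lift F r s HF.
Let HTi i : circle_lift (itn T i) := lift_itn T HT i.

(** Because [T] commutes with [Ph], the behaviour of [Ph] on one arc determines it on all images of
    that arc. The relation [Q] will be [<], [>] or equality. *)
Lemma next_transport (Q : R -> R -> Prop) y z :
  (forall u v i, Q u v -> Q (itn T i u) (itn T i v)) ->
  (forall x, y < x < z -> Q x (Ph x)) ->
  forall i x, itn T i y < x < itn T i z -> Q x (Ph x).
Proof.
intros HQ H i x Hx. destruct (lift_surj _ (HTi i) x) as [x' <-].
rewrite <- (itn_next_return F P q r s HF). apply HQ, H.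
split; now apply (lift_lt_inv _ (HTi i)).
Qed.

Lemma arc_image y w i n t : Per y -> Per w ->
  inArc (itn T ((i + p * n) mod q) y) (itn T ((i + p * n) mod q) w) t <->
  exists x, inArc (itn T i y) (itn T i w) x /\ eqm (itn F n x) t.
Proof.
intros Hy Hw. destruct (itn_F_next_mod F P q r s HF Hq bezout p n i Hp) as [k Hk].
generalize (Hk y Hy) (Hk w Hw). intros E1 E2.
assert (HFn := lift_itn F HF n). split.
- intros [m Hm]. destruct (lift_surj _ HFn (t + IZR (m + k))) as [x Hx].
  exists x. split; [| exists (m + k)%Z; lra].
  exists 0%Z. rewrite Rplus_0_r. rewrite plus_IZR in Hx.
  split; apply (lift_le_inv _ HFn); lra.
- intros (x & [m [h1 h2]] & [j Hj]).
  apply (lift_le _ HFn) in h1, h2. rewrite (lift_IZR _ HFn) in h1, h2.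
  exists (j + m - k)%Z. rewrite minus_IZR, plus_IZR. lra.
Qed.

Lemma open_arc_image y w i n x : Per y -> Per w ->
  inOArc (itn T i y) (itn T i w) x ->
  inOArc (itn T ((i + p * n) mod q) y) (itn T ((i + p * n) mod q) w) (itn F n x).
Proof.
intros Hy Hw [m [h1 h2]].
destruct (itn_F_next_mod F P q r s HF Hq bezout p n i Hp) as [k Hk].
generalize (Hk y Hy) (Hk w Hw). intros E1 E2.
assert (HFn := lift_itn F HF n).
apply (lift_lt _ HFn) in h1, h2. rewrite (lift_IZR _ HFn) in h1, h2.
exists (m - k)%Z. rewrite minus_IZR. lra.
Qed.

Lemma per_eqm x k : Per (x + IZR k) -> eqm (itn F q x) x.
Proof.
intros H. apply return_per in H.
rewrite (lift_IZR _ (lift_itn F HF q)), INR_IZR_INZ in H. exists (Z.of_nat P). lra.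
Qed.

(** A displacement [m] in [n] steps gives [m / n = P / q], so [Ph^n] fixes [x]; an increasing map
    fixes each of its periodic points. *)
Lemma eqm_per n x : (0 < n)%nat -> eqm (itn F n x) x -> Per x.
Proof.
intros Hn [m Hm].
assert (E : INR n * al = IZR m).
{ apply Rle_antisym; [apply (rotation_le F al n m x) | apply (rotation_ge F al n m x)];
    trivial; lra. }
assert (E' : (Z.of_nat q * m)%Z = (Z.of_nat n * Z.of_nat P)%Z).
{ apply eq_IZR. rewrite !mult_IZR, <- !INR_IZR_INZ, <- E, <- Hal. ring. }
assert (E2 : itn Ph n x = x).
{ unfold return_map. rewrite (itn_shift _ (lift_itn F HF q)), <- itn_mul, Nat.mul_comm, itn_mul.
  assert (K : forall k, itn (itn F n) k x = x + IZR (Z.of_nat k * m)).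
  { induction k as [|k IH]; [simpl; ring |]. rewrite Nat2Z.inj_succ, Z.mul_succ_l, plus_IZR.
    simpl itn. rewrite IH, (lift_IZR _ (lift_itn F HF n)). lra. }
  rewrite K, E', mult_IZR, opp_IZR, <- (INR_IZR_INZ n). ring. }
destruct (Rtotal_order x (Ph x)) as [h | [h | h]]; [| now symmetry |].
- apply (itn_gt Ph HPh n) in h; trivial. lra.
- apply (itn_lt Ph HPh n) in h; trivial. lra.
Qed.

(** The orbit of [y] repels and that of [z] attracts. The equalities [y = z] and [z = T y] are
    allowed: they give a single orbit, attracting on one side and repelling on the other. *)
Lemma picture_A y z : Per y -> Per z -> y <= z <= T y ->
  (forall x, y < x < z -> x < Ph x) -> (forall x, z < x < T y -> Ph x < x) ->
  let ym i := itn T i y in let zp i := itn T i z in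
  caseA F p q ym ym zp zp /\
  (forall i x, (i < q)%nat -> inArc (ym i) (ym i) x \/ inArc (zp i) (zp i) x ->
     eqm (itn F q x) x) /\
  (forall x, (forall i, (i < q)%nat ->
       ~ inArc (ym i) (ym i) x /\ ~ inArc (zp i) (zp i) x) -> ~ Per x).
Proof.
intros Hy Hz [Hyz HzT] Hup Hdown ym zp.
assert (next := fun i hi => itn_next_nextv F P q r s HF Hq bezout y i Hy hi).
assert (per := per_itn_next F P q r s HF).
assert (perT := per_next F P q r s HF y Hy).
assert (perq : forall t, Per t -> itn F q t = t + IZR (Z.of_nat P)).
{ intros t Ht. rewrite <- INR_IZR_INZ. now apply return_per. }
assert (up : forall i x, itn T i y < x < itn T i z -> x < Ph x).
{ apply (next_transport (fun u v => u < v)); trivial.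
  intros u v i h. now apply (lift_lt _ (HTi i)). }
assert (down : forall i x, itn T i z < x < itn T i (T y) -> Ph x < x).
{ apply (next_transport (fun u v => v < u)); trivial.
  intros u v i h. now apply (lift_lt _ (HTi i)). }
split; [| split].
- repeat split; unfold ym, zp.
  + intros i hi. now apply (lift_le _ (HTi i)).
  + intros i hi. rewrite itn_S. now apply (lift_le _ (HTi i)).
  + simpl itn at 2. rewrite <- (next_q F P q r s HF bezout y Hy).
    apply Rle_trans with (itn T (S (q - 1)) y).
    * rewrite itn_S. now apply (lift_le _ (HTi _)).
    * right. f_equal. lia.
  + destruct (itn_F_next_mod F P q r s HF Hq bezout p n i Hp) as [k Hk].
    exists k. rewrite (Hk y Hy). ring.
  + destruct (itn_F_next_mod F P q r s HF Hq bezout p n i Hp) as [k Hk].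
    exists k. rewrite (Hk z Hz). ring.
  + intros n. now apply open_arc_image.
  + apply (heteroclinic_up F q (Z.of_nat P) (itn T i y)); auto.
    intros t Ht. generalize (up i t Ht). unfold return_map. rewrite opp_IZR. lra.
  + apply (heteroclinic_up F q (Z.of_nat P) _ (itn T i z)); auto.
    intros t Ht. generalize (up i t Ht). unfold return_map. rewrite opp_IZR. lra.
  + intros n. rewrite next in * by (trivial; apply Nat.mod_upper_bound; lia).
    now apply open_arc_image.
  + rewrite next in * by trivial.
    apply (heteroclinic_down F q (Z.of_nat P) _ (itn T i (T y))); auto.
    intros t Ht. generalize (down i t Ht). unfold return_map. rewrite opp_IZR. lra.
  + rewrite next in * by trivial.
    apply (heteroclinic_down F q (Z.of_nat P) (itn T i z)); auto.
    intros t Ht. generalize (down i t Ht). unfold return_map. rewrite opp_IZR. lra.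
- intros i x hi [[k Hk] | [k Hk]]; apply (per_eqm x k).
  + replace (x + IZR k) with (itn T i y) by (unfold ym in Hk; lra). now apply per.
  + replace (x + IZR k) with (itn T i z) by (unfold zp in Hk; lra). now apply per.
- intros x Hx Hperx.
  destruct (orbit_locate F P q r s HF Hq bezout y x Hy) as (i & k & hi & h1 & h2).
  destruct (Hx i hi) as [n1 n2]. rewrite itn_S in h2.
  apply (per_shift F P q HF k) in Hperx.
  destruct (Rtotal_order (x + IZR k) (itn T i z)) as [h | [h | h]].
  + destruct h1 as [h1 | h1]; [| apply n1; exists k; unfold ym; lra].
    generalize (up i (x + IZR k) ltac:(lra)). lra.
  + apply n2. exists k. unfold zp. lra.
  + generalize (down i (x + IZR k) ltac:(lra)). lra.
Qed.

Lemma picture_B y z : Per y -> Per z -> y < z <= T y ->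
  (forall x, y < x < z -> Per x) -> (forall x, z < x < T y -> Ph x < x) ->
  let yL i := itn T i y in let zR i := itn T i z in
  caseB F p q yL zR yL zR /\
  (forall i x, (i < q)%nat -> inArc (yL i) (zR i) x -> eqm (itn F q x) x) /\
  (forall x, (forall i, (i < q)%nat -> ~ inArc (yL i) (zR i) x) -> ~ Per x).
Proof.
intros Hy Hz [Hyz HzT] Hid Hdown yL zR.
assert (next := fun i hi => itn_next_nextv F P q r s HF Hq bezout y i Hy hi).
assert (per := per_itn_next F P q r s HF).
assert (perT := per_next F P q r s HF y Hy).
assert (perq : forall t, Per t -> itn F q t = t + IZR (Z.of_nat P)).
{ intros t Ht. rewrite <- INR_IZR_INZ. now apply return_per. }
assert (id : forall i x, itn T i y <= x <= itn T i z -> Per x).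
{ intros i x [[h1 | <-] [h2 | ->]]; auto.
  symmetry. apply (next_transport (fun u v => u = v) y z) with i; auto.
  - intros u v j ->. reflexivity.
  - intros t Ht. symmetry. auto. }
assert (down : forall i x, itn T i z < x < itn T i (T y) -> Ph x < x).
{ apply (next_transport (fun u v => v < u)); trivial.
  intros u v i h. now apply (lift_lt _ (HTi i)). }
assert (arcs : forall i x, inArc (yL i) (zR i) x -> eqm (itn F q x) x).
{ intros i x [k Hk]. apply (per_eqm x k). now apply (id i). }
split; [| split].
- repeat split; unfold yL, zR.
  + intros i hi. now apply (lift_lt _ (HTi i)).
  + intros i hi. rewrite itn_S. now apply (lift_le _ (HTi i)).
  + simpl itn at 2. rewrite <- (next_q F P q r s HF bezout y Hy).
    apply Rle_trans with (itn T (S (q - 1)) y).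
    * rewrite itn_S. now apply (lift_le _ (HTi _)).
    * right. f_equal. lia.
  + intros [i [hi h]] j hj. rewrite next in * by trivial.
    apply (lift_lt _ (HTi j)). now apply (lift_lt_inv _ (HTi i)).
  + intros h. exists 0%nat. auto.
  + intros n. rewrite next in * by (trivial; apply Nat.mod_upper_bound; lia).
    now apply open_arc_image.
  + rewrite next in * by trivial.
    apply (heteroclinic_down F q (Z.of_nat P) _ (itn T i (T y))); auto.
    intros t Ht. generalize (down i t Ht). unfold return_map. rewrite opp_IZR. lra.
  + rewrite next in * by trivial.
    apply (heteroclinic_down F q (Z.of_nat P) (itn T i z)); auto.
    intros t Ht. generalize (down i t Ht). unfold return_map. rewrite opp_IZR. lra.
  + intros h x. exists q. split; trivial.
    destruct (orbit_locate F P q r s HF Hq bezout y x Hy) as (i & k & hi & h1 & h2).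
    apply (arcs i). exists k. unfold yL, zR. rewrite h, next by trivial.
    rewrite itn_S in h2. lra.
- intros i x _. apply arcs.
- intros x Hx Hperx.
  destruct (orbit_locate F P q r s HF Hq bezout y x Hy) as (i & k & hi & h1 & h2).
  rewrite itn_S in h2. apply (per_shift F P q HF k) in Hperx.
  destruct (Rle_lt_dec (x + IZR k) (itn T i z)) as [h | h].
  + apply (Hx i hi). exists k. unfold yL, zR. lra.
  + generalize (down i (x + IZR k) ltac:(lra)). lra.
Qed.

(** If [F^j (a, T x0)] contained [a + m], the periodic point [w = F^j x0 - m] would satisfy
    [w <= a < T w], hence [w <= x0] by the choice of [x0]. If [w < x0], then [x0], a translate of a
    point of the orbit of [w], lies between [w] and its successor. If [w = x0], then [q] divides
    [j], so [j = 0] and [m = 0], and [a < a] follows. *)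
Lemma no_kink x0 : Per x0 -> x0 <= a < T x0 ->
  (forall t, Per t -> t <= a -> t <= x0) ->
  forall j m, (j < q)%nat -> ~ (itn F j a < a + IZR m < itn F j (T x0)).
Proof.
intros H0 [h1 h2] Hlast j m Hj [k1 k2].
assert (HFj := lift_itn F HF j).
set (w := itn F j x0 + IZR (- m)).
assert (Hw : Per w) by (apply per_shift, per_itn_F; trivial).
assert (L : itn F j x0 <= itn F j a) by now apply (lift_le _ HFj).
assert (wle : w <= x0) by (apply Hlast; trivial; unfold w; rewrite opp_IZR; lra).
assert (E : T w = itn F j (T x0) - IZR m).
{ unfold w. rewrite (lift_IZR T HT), opp_IZR.
  rewrite (itn_comm F T) by (intros; symmetry; now apply next_F). ring. }
destruct wle as [wlt | weq].
- apply (no_orbit_between F P q r s HF Hq bezout w (q - j) (m - Z.of_nat P) Hw).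
  replace (itn F (q - j) w + IZR (m - Z.of_nat P)) with x0; [lra |].
  unfold w. rewrite (lift_IZR _ (lift_itn F HF _)), <- itn_add.
  replace (q - j + j)%nat with q by lia.
  rewrite (proj1 (return_per F P q x0) H0), minus_IZR, opp_IZR, <- INR_IZR_INZ. ring.
- assert (Ej : itn F j x0 = x0 + IZR m) by (unfold w in weq; rewrite opp_IZR in weq; lra).
  assert (Em : INR j * al = IZR m).
  { apply Rle_antisym; [apply (rotation_le F al j m x0) | apply (rotation_ge F al j m x0)];
      trivial; lra. }
  assert (E' : (Z.of_nat q * m)%Z = (Z.of_nat j * Z.of_nat P)%Z).
  { apply eq_IZR. rewrite !mult_IZR, <- !INR_IZR_INZ, <- Em, <- Hal. ring. }
  assert (E2 : Z.of_nat j = (Z.of_nat q * (Z.of_nat r * m + s * Z.of_nat j))%Z).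
  { transitivity (Z.of_nat j * (Z.of_nat r * Z.of_nat P + s * Z.of_nat q))%Z;
      [rewrite bezout; ring |].
    transitivity (Z.of_nat r * (Z.of_nat j * Z.of_nat P) + s * Z.of_nat q * Z.of_nat j)%Z;
      [ring |]. rewrite <- E'. ring. }
  set (c := (Z.of_nat r * m + s * Z.of_nat j)%Z) in *.
  assert (c = 0%Z) by nia. assert (j = 0%nat) by nia. subst j.
  simpl in Em. rewrite Rmult_0_l in Em. simpl in k1. lra.
Qed.

Lemma rational_dichotomy : exists y z, Per y /\ Per z /\ y <= z <= T y /\
  (forall x, z < x < T y -> Ph x < x) /\
  ((forall x, y < x < z -> x < Ph x) \/
   (y < z /\ (forall x, y < x < z -> Per x) /\ ~ strict)).
Proof.
destruct (periodic_point_exists F al q (Z.of_nat P) HF Hrot) as [z0 Hz0].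
{ now rewrite <- INR_IZR_INZ. }
rewrite <- INR_IZR_INZ in Hz0. apply return_per in Hz0.
destruct (archimed (a - z0)) as [ar1 ar2].
destruct (last_fixed_point Ph a (z0 + IZR (up (a - z0) - 1)) HPh) as (x0 & Hx0 & x0a & last).
{ now apply per_shift. }
{ rewrite minus_IZR. lra. }
destruct (first_fixed_point Ph a (z0 + IZR (up (a - z0))) HPh) as (y0 & Hy0 & ay0 & first).
{ now apply per_shift. }
{ lra. }
assert (HTx0 := per_next F P q r s HF x0 Hx0).
assert (gtT := next_gt F P q r s HF Hq bezout x0 Hx0).
assert (aT : a < T x0).
{ apply Rnot_le_lt. intros h. generalize (last _ HTx0 h). lra. }
assert (y0T : y0 <= T x0) by (apply first; trivial; lra).
assert (nofix : forall x, x0 < x < y0 -> Ph x <> x).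
{ intros x hx E. destruct (Rle_lt_dec x a) as [h | h].
  - generalize (last x E h). lra.
  - generalize (first x E ltac:(lra)). lra. }
assert (sign := no_fixed_point_sign Ph x0 y0 HPh nofix).
destruct y0T as [y0T | y0T].
(* The gap around the kink is a whole arc from [x0] to its successor, so there is a single periodic
   orbit and the sign of [Ph - id] settles case (a), with [z = T y] or [z = y]. *)
2:{ rewrite y0T in sign. destruct sign as [up | down].
  - exists x0, (T x0). do 2 (split; trivial). split; [lra |]. split; [| now left].
    intros x hx. lra.
  - exists x0, x0. do 2 (split; trivial). split; [lra |]. split; trivial.
    left. intros x hx. lra. }
assert (kink := no_kink x0 Hx0 (conj x0a aT) last).
assert (conc : concave_btw (itn F q) a (T x0)).
{ apply (itn_concave F a); trivial. now left. }
set (f := itn F q) in *.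
assert (Ef : forall t, Per t -> f t = t + INR P) by (intros t; apply return_per).
assert (Pf : forall t, Ph t = f t - INR P).
{ intros t. unfold return_map. rewrite opp_IZR, <- INR_IZR_INZ. reflexivity. }
(* [Ph - id] is concave on [[y0, T x0]] and vanishes at both ends. *)
assert (ge : forall x, y0 < x < T x0 -> x <= Ph x).
{ intros x hx. generalize (concave_slopes f _ _ conc y0 x (T x0) ay0 (proj1 hx) (proj2 hx)
    (Rle_refl _)).
  rewrite (Ef y0 Hy0), (Ef _ HTx0), Pf. intros K.
  assert (f x - INR P - x >= 0); [| lra]. nra. }
assert (down : forall x, T x0 < x < T y0 -> Ph x < x).
{ apply (next_transport (fun u v => v < u) x0 y0) with (i := 1%nat).
  { intros u v i h. now apply (lift_lt _ (HTi i)). }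
  (* Otherwise [Ph - id] would be positive at a point [u] of [(a, y0)] and zero at [y0] and [T x0].
     All three lie in [[a, T x0]], so their chord slopes would contradict concavity. *)
  destruct sign as [up | down]; trivial. intros x hx. exfalso.
  assert (a < y0).
  { destruct ay0 as [h | h]; trivial. generalize (last a ltac:(congruence) (Rle_refl a)). lra. }
  set (u := (a + y0) / 2).
  assert (hu : a < u < y0) by (unfold u; lra).
  generalize (concave_slopes f _ _ conc u y0 (T x0) ltac:(lra) (proj2 hu) y0T
    (Rle_refl _)).
  specialize (up u ltac:(lra)). rewrite Pf in up.
  rewrite (Ef y0 Hy0), (Ef _ HTx0). intros K. nra. }
exists y0, (T x0). do 2 (split; trivial).
split; [split; [lra | apply (lift_le T HT); lra] |]. split; trivial.
destruct (classic (exists u, y0 < u < T x0 /\ Per u)) as [[u [hu Hu]] | none].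
2:{ left. intros x hx. destruct (ge x hx) as [h | h]; trivial.
  exfalso. apply none. exists x. split; trivial. now symmetry. }
(* A nonnegative concave function with an interior zero vanishes identically. *)
assert (all : forall x, y0 < x < T x0 -> Per x).
{ intros x hx. apply Rle_antisym; [| now apply ge]. rewrite Pf.
  destruct (Rtotal_order x u) as [h | [h | h]].
  - generalize (concave_slopes f _ _ conc x u (T x0) ltac:(lra) h (proj2 hu) (Rle_refl _)).
    rewrite (Ef u Hu), (Ef _ HTx0). intros K. nra.
  - subst. rewrite (Ef u Hu). lra.
  - generalize (concave_slopes f _ _ conc y0 u x ay0 (proj1 hu) h ltac:(lra)).
    rewrite (Ef u Hu), (Ef _ Hy0). intros K. nra. }
right. do 2 (split; trivial). intros Hs.
assert (sc : strictly_concave_btw f a (T x0)).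
{ apply (itn_strictly_concave F a); auto. now left. }
generalize (sc y0 (T x0) (1 / 2) ltac:(lra) ltac:(lra) ltac:(lra) ltac:(lra)).
assert (Hm : Per (1 / 2 * y0 + (1 - 1 / 2) * T x0)) by (apply all; lra).
rewrite (Ef _ Hm), (Ef _ Hy0), (Ef _ HTx0). lra.
Qed.

Lemma rational_rotation_picture : rational_picture F p q strict.
Proof.
destruct rational_dichotomy as (y & z & Hy & Hz & [Hyz HzT] & down & dich).
assert (Ty1 : forall i, itn T i (T y) <= itn T i y + 1).
{ intros i. rewrite <- (lift_1 _ (HTi i)). apply (lift_le _ (HTi i)).
  now apply (next_le_1 F P q r s HF Hq bezout). }
destruct dich as [up | (Hlt & id & Hns)].
- destruct (picture_A y z) as (A1 & A2 & A3); auto.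
  exists (fun i => itn T i y), (fun i => itn T i y),
    (fun i => itn T i z), (fun i => itn T i z).
  split; [intros i hi; lra |]. split; [exact A2 |].
  split; [intros; split; now apply arc_image |].
  split; [| split; [now left | trivial]].
  intros x Hx n Hn E. apply (A3 x Hx). now apply (eqm_per n).
- destruct (picture_B y z) as (B1 & B2 & B3); auto.
  exists (fun i => itn T i y), (fun i => itn T i z),
    (fun i => itn T i y), (fun i => itn T i z).
  assert (h : forall i, itn T i y <= itn T i z <= itn T i y + 1).
  { intros i. generalize (Ty1 i) (lift_le _ (HTi i) _ _ Hyz) (lift_le _ (HTi i) _ _ HzT).
    lra. }
  split; [intros i hi; generalize (h i); lra |].
  split; [intros i x hi [H | H]; now apply (B2 i) |].
  split; [intros; split; now apply arc_image |].
  split; [| split; [now right | intros; contradiction]].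
  intros x Hx n Hn E. apply (B3 x); [| now apply (eqm_per n)].
  intros i hi. now apply Hx.
Qed.

End RationalPicture.

(** * Irrational rotation number: Denjoy's argument *)

Definition irrational (al : R) : Prop :=
  forall (n : nat) (m : Z), (0 < n)%nat -> INR n * al <> IZR m.

Lemma least_nat (A : nat -> Prop) : (exists n, A n) ->
  exists n, A n /\ forall m, (m < n)%nat -> ~ A m.
Proof.
intros [n Hn]. revert Hn. induction n as [n IH] using (well_founded_induction lt_wf).
intros Hn. destruct (classic (exists m, (m < n)%nat /\ A m)) as [[m [h1 h2]] | H].
- now apply (IH m).
- exists n. split; trivial. intros m hm hA. apply H. now exists m.
Qed.

Lemma infimum_approx (S : R -> Prop) : (exists t, S t) -> (forall t, S t -> 0 < t) ->
  exists i, 0 <= i /\ (forall t, S t -> i <= t) /\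
    forall e, 0 < e -> exists t, S t /\ t < i + e.
Proof.
intros [t0 H0] Hpos.
destruct (completeness (fun t => S (- t))) as [i [ub lub]].
{ exists 0. intros t Ht. specialize (Hpos _ Ht). lra. }
{ exists (- t0). now rewrite Ropp_involutive. }
exists (- i). split; [| split].
- assert (i <= 0); [| lra]. apply lub. intros t Ht. specialize (Hpos _ Ht). lra.
- intros t Ht. assert (- t <= i); [| lra]. apply ub. now rewrite Ropp_involutive.
- intros e He. apply NNPP. intros H. assert (i <= i - e); [| lra].
  apply lub. intros t Ht. apply Rnot_lt_le. intros h. apply H. exists (- t).
  split; trivial. lra.
Qed.

(* With [S] the positive values of [n al - k] and [S'] those of [k - n al],
   a difference of elements of [S] and [S'] lies in [S] or in the opposite of
   [S'], which is impossible near the infima unless [inf S = 0]. *)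
Lemma irrational_small al eps : irrational al -> 0 < eps ->
  exists n k, (0 < n)%nat /\ 0 < INR n * al - IZR k < eps.
Proof.
intros irr Heps. apply NNPP. intros none.
set (S := fun t => 0 < t /\ exists n k, (0 < n)%nat /\ t = INR n * al - IZR k).
set (S' := fun t => 0 < t /\ exists n k, (0 < n)%nat /\ t = IZR k - INR n * al).
assert (diff : forall t t', S t -> S' t' -> t' < t -> S (t - t')).
{ intros t t' [_ (n & k & hn & ->)] [_ (n' & k' & hn' & ->)] h. split; [lra |].
  exists (n + n')%nat, (k + k')%Z. split; [lia |]. rewrite plus_INR, plus_IZR. ring. }
assert (diff' : forall t t', S t -> S' t' -> t < t' -> S' (t' - t)).
{ intros t t' [_ (n & k & hn & ->)] [_ (n' & k' & hn' & ->)] h. split; [lra |].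
  exists (n + n')%nat, (k + k')%Z. split; [lia |]. rewrite plus_INR, plus_IZR. ring. }
assert (neq : forall t t', S t -> S' t' -> t <> t').
{ intros t t' [_ (n & k & hn & ->)] [_ (n' & k' & hn' & ->)] h.
  apply (irr (n + n')%nat (k + k')%Z); [lia |]. rewrite plus_INR, plus_IZR. lra. }
destruct (archimed al) as [u1 u2].
destruct (infimum_approx S) as (i & i0 & lb & ap).
{ exists (al - IZR (up al - 2)). rewrite minus_IZR. split; [lra |].
  exists 1%nat, (up al - 2)%Z. split; [lia |]. rewrite minus_IZR. simpl. ring. }
{ now intros t [h _]. }
destruct (infimum_approx S') as (i' & i0' & lb' & ap').
{ exists (IZR (up al) - al). split; [lra |].
  exists 1%nat, (up al). split; [lia |]. simpl. ring. }
{ now intros t [h _]. }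
assert (ipos : eps <= i).
{ apply Rnot_lt_le. intros h. destruct (ap (eps - i)) as [t [[ht (n & k & hn & E)] ht']]; [lra |].
  apply none. exists n, k. split; trivial. lra. }
assert (ge : forall t', S' t' -> i <= t').
{ intros t' Ht'. apply Rnot_lt_le. intros h. assert (0 < t') by apply Ht'.
  destruct (ap t') as [t [Ht ht]]; trivial. assert (hi := lb t Ht).
  assert (K := lb _ (diff t t' Ht Ht' ltac:(lra))). lra. }
assert (i <= i').
{ apply Rnot_lt_le. intros h. destruct (ap' (i - i')) as [t [Ht ht]]; [lra |].
  specialize (ge t Ht). lra. }
destruct (ap i') as [t [Ht ht]]; [lra |]. destruct (ap' i) as [t' [Ht' ht']]; [lra |].
destruct (Rtotal_order t t') as [h | [h | h]].
- assert (K := lb' _ (diff' t t' Ht Ht' h)). specialize (lb t Ht). lra.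
- now apply (neq t t').
- assert (K := lb _ (diff t t' Ht Ht' h)). specialize (lb' t' Ht'). lra.
Qed.

Lemma irrational_dense al u v : irrational al -> u < v ->
  exists n k, u < INR n * al + IZR k < v.
Proof.
intros irr huv.
destruct (irrational_small al (v - u) irr ltac:(lra)) as (n & k & hn & h1 & h2).
set (s := INR n * al - IZR k) in *.
destruct (archimed u) as [u1 u2]. set (K := (up u - 1)%Z).
assert (hK : IZR K <= u) by (unfold K; rewrite minus_IZR; lra).
destruct (archimed ((u - IZR K) / s)) as [j1 j2].
(* The first multiple of [s] that passes [u] when starting from [K]; it overshoots by at most
   [s < v - u]. *)
set (j := up ((u - IZR K) / s)) in *.
assert (hj : 0 < IZR j).
{ apply Rle_lt_trans with (2 := j1). apply Rdiv_le_0_compat; lra. }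
apply lt_IZR in hj.
assert (E : (u - IZR K) / s * s = u - IZR K) by (field; lra).
exists (Z.to_nat j * n)%nat, (K - j * k)%Z.
rewrite mult_INR, minus_IZR, mult_IZR, (INR_IZR_INZ (Z.to_nat j)), Z2Nat.id by lia.
replace (IZR j * INR n * al + (IZR K - IZR j * IZR k)) with (IZR j * s + IZR K)
  by (unfold s; ring).
set (z := (u - IZR K) / s) in *. split; nra.
Qed.

(* [m < n1] are successive records of [n al mod 1] towards 0 from above, so
   that [(n1 - m) al] comes back from below at a distance smaller than that of
   [m al]; the first such return before time [n1] is closest on both sides. *)
Lemma closest_return al eps : irrational al -> 0 < eps ->
  exists (q : nat) (p : Z), (0 < q)%nat /\ 0 < IZR p - INR q * al < eps /\
    forall n k, (0 < n < q)%nat -> IZR p - INR q * al < Rabs (INR n * al - IZR k).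
Proof.
(* The cap at 1 excludes [n1 = m]: two remainders of the same [n al] in [(0, 1)] cannot differ by a
   nonzero integer. *)
intros irr Heps. set (e := Rmin eps 1).
assert (e1 : 0 < e <= 1 /\ e <= eps).
{ unfold e. generalize (Rmin_l eps 1) (Rmin_r eps 1) (Rmin_glb_lt eps 1 0). lra. }
destruct (least_nat (fun m => (0 < m)%nat /\ exists k, 0 < INR m * al - IZR k < e))
  as (m & (hm & k & hl) & minm).
{ destruct (irrational_small al e irr) as (n & k & hn & h); [lra |].
  exists n. split; trivial. now exists k. }
set (l := INR m * al - IZR k) in *.
destruct (least_nat (fun n => (0 < n)%nat /\ exists k, 0 < INR n * al - IZR k < l))
  as (n1 & (hn1 & k1 & hl1) & minn1).
{ destruct (irrational_small al l irr) as (n & k' & hn & h); [lra |].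
  exists n. split; trivial. now exists k'. }
assert (lt1 : (m < n1)%nat).
{ destruct (Nat.lt_trichotomy m n1) as [h | [h | h]]; trivial; exfalso.
  - rewrite <- h in hl1. assert (k < k1)%Z by (apply lt_IZR; unfold l in hl1; lra).
    assert (hk : (k + 1 <= k1)%Z) by lia. apply IZR_le in hk. rewrite plus_IZR in hk.
    unfold l in hl, hl1. lra.
  - apply (minm n1 h). split; trivial. exists k1. lra. }
destruct (least_nat (fun n => (0 < n)%nat /\ exists k, 0 < IZR k - INR n * al < l))
  as (q & (hq & p & hp) & minq).
{ exists (n1 - m)%nat. split; [lia |]. exists (k1 - k)%Z.
  rewrite minus_INR, minus_IZR by lia. unfold l in *. lra. }
assert (q <= n1 - m)%nat.
{ apply Nat.nlt_ge. intros h. apply (minq _ h). split; [lia |]. exists (k1 - k)%Z.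
  rewrite minus_INR, minus_IZR by lia. unfold l in *. lra. }
exists q, p. split; trivial. split; [lra |].
intros n j [h1 h2]. destruct (Rtotal_order (INR n * al - IZR j) 0) as [h | [h | h]].
- rewrite Rabs_left by trivial. apply Rlt_le_trans with l; [lra |].
  apply Rnot_lt_le. intros h'. apply (minq n h2). split; trivial. exists j. lra.
- exfalso. apply (irr n j h1). lra.
- rewrite Rabs_pos_eq by lra. apply Rlt_le_trans with l; [lra |].
  apply Rnot_lt_le. intros h'. apply (minn1 n ltac:(lia)). split; trivial. exists j. lra.
Qed.

(** The value [h x] locates [x] among the points [F^n 0 + m], each given the label [n al + m].
    Writing [n = n1 - n2] and applying [F^n2] to [x] covers negative times without inverse
    iterates. *)
Lemma semiconjugacy F al : circle_lift F -> has_rotation F al ->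
  exists h : R -> R, (forall x y, x <= y -> h x <= h y) /\
    (forall x, h (x + 1) = h x + 1) /\ (forall x, h (F x) = h x + al).
Proof.
intros HF Hr.
set (E := fun x t => exists (n1 n2 : nat) (m : Z),
  itn F n1 0 + IZR m <= itn F n2 x /\ t = (INR n1 - INR n2) * al + IZR m).
assert (lub : forall x, {s | is_lub (E x) s}).
{ intros x. destruct (archimed x) as [a1 a2]. apply completeness.
  - exists (IZR (up x)). intros t (n1 & n2 & m & h & ->).
    assert (h' : itn F n1 0 + IZR m <= itn F n2 0 + IZR (up x)).
    { rewrite <- (lift_IZR _ (lift_itn F HF n2)). apply Rle_trans with (1 := h).
      apply (lift_le _ (lift_itn F HF n2)). lra. }
    destruct (le_lt_dec n2 n1) as [hn | hn].
    + assert (K : itn F (n1 - n2) 0 <= 0 + IZR (up x - m)).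
      { apply (lift_le_inv _ (lift_itn F HF n2)).
        rewrite <- itn_add, (lift_IZR _ (lift_itn F HF n2)), minus_IZR.
        replace (n2 + (n1 - n2))%nat with n1 by lia. lra. }
      apply (rotation_le F al _ _ _ HF Hr) in K.
      rewrite minus_INR, minus_IZR in K by trivial. lra.
    + assert (K : 0 + IZR (m - up x) <= itn F (n2 - n1) 0).
      { apply (lift_le_inv _ (lift_itn F HF n1)).
        rewrite <- itn_add, (lift_IZR _ (lift_itn F HF n1)), minus_IZR.
        replace (n1 + (n2 - n1))%nat with n2 by lia. lra. }
      apply (rotation_ge F al _ _ _ HF Hr) in K.
      rewrite minus_INR, minus_IZR in K by lia. lra.
  - exists (IZR (up x - 1)), 0%nat, 0%nat, (up x - 1)%Z. rewrite minus_IZR.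
    simpl. split; lra. }
set (h := fun x => proj1_sig (lub x)).
(* All three properties of [h] come from translations between the sets [E x]. *)
assert (shift : forall x y c, (forall t, E x t -> E y (t + c)) -> h x + c <= h y).
{ intros x y c H. unfold h.
  destruct (lub x) as [s [ub ls]], (lub y) as [s' [ub' ls']]. simpl.
  assert (s <= s' - c); [| lra]. apply ls. intros t Ht. apply H, ub' in Ht. lra. }
exists h. split; [| split].
- intros x y hxy. rewrite <- (Rplus_0_r (h x)). apply shift.
  intros t (n1 & n2 & m & H & ->). exists n1, n2, m. split; [| ring].
  apply Rle_trans with (1 := H). now apply (lift_le _ (lift_itn F HF n2)).
- intros x. apply Rle_antisym.
  + assert (h (x + 1) + - (1) <= h x); [| lra]. apply shift.
    intros t (n1 & n2 & m & H & ->). exists n1, n2, (m - 1)%Z.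
    rewrite (lift_1 _ (lift_itn F HF n2)) in H. rewrite minus_IZR. split; [lra | ring].
  + apply shift. intros t (n1 & n2 & m & H & ->). exists n1, n2, (m + 1)%Z.
    rewrite (lift_1 _ (lift_itn F HF n2)), plus_IZR. split; [lra | ring].
- intros x. apply Rle_antisym.
  + assert (h (F x) + - al <= h x); [| lra]. apply shift.
    intros t (n1 & n2 & m & H & ->). exists n1, (S n2), m.
    rewrite itn_S, S_INR. split; [lra | ring].
  + apply shift. intros t (n1 & n2 & m & H & ->). exists (S n1), n2, m.
    rewrite <- itn_S, S_INR. split; [| ring]. simpl itn.
    rewrite <- (lift_IZR F HF). now apply (lift_le F HF).
Qed.

Lemma lift_Tmap h : circle_lift h -> Tmap h.
Proof.
intros Hh x y [k Hk]. exists k. replace x with (y + IZR k) by lra.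
rewrite (lift_IZR h Hh). ring.
Qed.

Lemma lift_Tcont h : circle_lift h -> Tcont h.
Proof.
intros Hh x eps He.
destruct (lift_surj h Hh (h x - eps)) as [l Hl].
destruct (lift_surj h Hh (h x + eps)) as [r Hr].
assert (l < x) by (apply (lift_lt_inv h Hh); lra).
assert (x < r) by (apply (lift_lt_inv h Hh); lra).
exists (Rmin (x - l) (r - x)). split; [apply Rmin_glb_lt; lra |].
intros y Hy. destruct (dT_attained x y) as [k Hk]. rewrite <- Hk in Hy.
assert (B1 := Rlt_le_trans _ _ _ Hy (Rmin_l _ _)).
assert (B2 := Rlt_le_trans _ _ _ Hy (Rmin_r _ _)).
apply Rabs_def2 in B1, B2.
apply Rle_lt_trans with (1 := dT_le _ _ k).
assert (C1 : h l < h (y + IZR k)) by (apply (lift_lt h Hh); lra).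
assert (C2 : h (y + IZR k) < h r) by (apply (lift_lt h Hh); lra).
rewrite (lift_IZR h Hh) in C1, C2. apply Rabs_def1; lra.
Qed.

Lemma lift_Thomeo h : circle_lift h -> Thomeo h.
Proof.
intros Hh. assert (Hk := lift_Finv h Hh).
split; [now apply lift_Tmap | split; [now apply lift_Tcont |]].
exists (Finv h). split; [now apply lift_Tmap | split; [now apply lift_Tcont |]].
split; intros x; exists 0%Z.
- rewrite (lift_Finv_l h Hh). ring.
- rewrite (lift_Finv_r h Hh). ring.
Qed.

Section IrrationalRotation.

Variables (F h : R -> R) (a la al : R).
Hypothesis HF : circle_lift F.
Hypothesis irr : irrational al.
Hypothesis Hconc : concave_btw F a (a + 1).
Hypothesis la_ge1 : 1 <= la.
Hypothesis lip : forall x y, x < y -> F y - F x <= la * (y - x).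
Hypothesis lip' : forall x y, x < y -> y - x <= la * (F y - F x).
Hypothesis hmono : forall x y, x <= y -> h x <= h y.
Hypothesis h1 : forall x, h (x + 1) = h x + 1.
Hypothesis hF : forall x, h (F x) = h x + al.

Lemma h_itn n x : h (itn F n x) = h x + INR n * al.
Proof.
induction n as [|n IH]; [simpl; ring |]. rewrite S_INR. simpl itn. rewrite hF, IH. ring.
Qed.

Lemma h_itn_Finv n x : h (itn (Finv F) n x) = h x - INR n * al.
Proof.
rewrite <- (itn_Finv_r F HF n x) at 2. rewrite h_itn. ring.
Qed.

Lemma h_lt_inv x y : h x < h y -> x < y.
Proof.
intros H. apply Rnot_le_lt. intros h'. apply hmono in h'. lra.
Qed.

(* Both intervals are moved along [q] iterates; as long as the kink is not
   between them the left one is expanded more, and the closest return property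
   lets the kink come between them only once. *)
Lemma distortion x1 y1 x2 y2 q de :
  x1 < y1 -> y1 < x2 -> x2 < y2 -> h y2 = h x1 + de ->
  (forall n k, (0 < n < q)%nat -> de < Rabs (INR n * al - IZR k)) ->
  (y1 - x1) * (itn F q y2 - itn F q x2) <=
  la * la * (itn F q y1 - itn F q x1) * (y2 - x2).
Proof.
intros hx hyx hy hde Hq.
set (A := fun n => itn F n y1 - itn F n x1). set (B := fun n => itn F n y2 - itn F n x2).
set (bad := fun j => exists m, itn F j x1 < a + IZR m < itn F j y2).
assert (Apos : forall n, 0 < A n).
{ intros n. unfold A. generalize (lift_lt _ (lift_itn F HF n) _ _ hx). lra. }
assert (Bpos : forall n, 0 < B n).
{ intros n. unfold B. generalize (lift_lt _ (lift_itn F HF n) _ _ hy). lra. }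
(* Applying [h], a kink between the intervals at time [i] puts [h a + m - i al] in
   [[h x1, h x1 + de]]. Two such times [i < j] would give a return at time [j - i < q] within
   [de]. *)
assert (once : forall i j, (i < j < q)%nat -> bad i -> ~ bad j).
{ intros i j [hij hjq] [m [b1 b2]] [m' [b3 b4]].
  apply Rlt_le, hmono in b1, b2, b3, b4.
  rewrite h_itn, (degree1_IZR h h1) in b1, b2, b3, b4.
  assert (K := Hq (j - i)%nat (m' - m)%Z ltac:(lia)).
  rewrite minus_INR, minus_IZR in K by lia.
  apply (Rlt_not_le _ _ K), Rabs_le. lra. }
assert (step : forall n, ~ bad n -> B (S n) * A n <= A (S n) * B n).
{ intros n Hn. assert (HFn := lift_itn F HF n).
  generalize (lift_lt _ HFn _ _ hx) (lift_lt _ HFn _ _ hyx) (lift_lt _ HFn _ _ hy).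
  intros o1 o2 o3.
  destruct (floor_interval a (itn F n x1) (itn F n y2)) as [m [f1 f2]]; [lra | |].
  { intros m Hm. apply Hn. now exists m. }
  apply (concave_slopes_disjoint F _ _ (concave_shift F a m HF Hconc)
    (itn F n x1) (itn F n y1) (itn F n x2) (itn F n y2)); lra. }
(* The ratio of expansions is at most 1 until the bad time; that one step costs a factor [la] for
   each interval. *)
assert (P : forall n, (n <= q)%nat ->
  ((forall j, (j < n)%nat -> ~ bad j) /\ A 0%nat * B n <= A n * B 0%nat) \/
  ((exists j, (j < n)%nat /\ bad j) /\ A 0%nat * B n <= la * la * A n * B 0%nat)).
{ induction n as [|n IH]; intros Hn.
  { left. split; [intros j hj; lia | lra]. }
  assert (gen : forall K, ~ bad n -> A 0%nat * B n <= K * A n * B 0%nat ->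
    A 0%nat * B (S n) <= K * A (S n) * B 0%nat).
  { intros K Hb HK. apply step in Hb. apply Rmult_le_reg_r with (A n); [apply Apos |].
    apply Rle_trans with (A 0%nat * (A (S n) * B n)).
    - rewrite Rmult_assoc. apply Rmult_le_compat_l; [left; apply Apos | trivial].
    - generalize (Rmult_le_compat_r (A (S n)) _ _ (Rlt_le _ _ (Apos (S n))) HK). lra. }
  destruct (classic (bad n)) as [Hb | Hb]; destruct IH as [[H1 H2] | [[j [hj H1]] H2]];
    try lia.
  - right. split; [exists n; split; [lia | trivial] |].
    generalize (Apos 0%nat) (Apos n) (Apos (S n)) (Bpos 0%nat) (Bpos n) (Bpos (S n)).
    generalize (lip _ _ (lift_lt _ (lift_itn F HF n) _ _ hy)).
    generalize (lip' _ _ (lift_lt _ (lift_itn F HF n) _ _ hx)).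
    fold (B n) (A n). change (F (itn F n y2) - F (itn F n x2)) with (B (S n)).
    change (F (itn F n y1) - F (itn F n x1)) with (A (S n)).
    intros L1 L2 a0 an asn b0 bn bsn.
    apply Rle_trans with (A 0%nat * (la * B n)); [apply Rmult_le_compat_l; lra |].
    apply Rle_trans with (la * (A n * B 0%nat)).
    + apply (Rmult_le_compat_l la) in H2; lra.
    + apply (Rmult_le_compat_r (B 0%nat)) in L1; [| lra].
      apply (Rmult_le_compat_l la) in L1; lra.
  - exfalso. now apply (once j n).
  - left. split.
    + intros j hj. destruct (Nat.eq_dec j n) as [-> | ne]; trivial. apply H1. lia.
    + generalize (gen 1 Hb). lra.
  - right. split; [exists j; split; [lia | trivial] |]. now apply gen. }
generalize (Apos q) (Bpos 0%nat). fold (A q). fold (B q).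
change (y1 - x1) with (A 0%nat). change (y2 - x2) with (B 0%nat). intros p1 p2.
destruct (P q (le_n q)) as [[_ H] | [_ H]]; trivial.
apply Rle_trans with (1 := H).
rewrite Rmult_assoc. rewrite <- (Rmult_1_l (A q * B 0%nat)) at 1.
apply Rmult_le_compat_r; nra.
Qed.

(** [Y] is the right end of the level set of [c], described so that the value of [h] at [Y] itself,
    where [h] may jump, does not matter. *)
Lemma plateau_right c x1 : h x1 = c -> exists Y,
  (forall t, c < h t -> Y <= t) /\ forall e, 0 < e -> c < h (Y + e).
Proof.
intros Hc. destruct (completeness (fun t => h t <= c)) as [Y [ub lub]].
- exists (x1 + 1). intros t Ht. apply Rnot_lt_le. intros H.
  apply Rlt_le, hmono in H. rewrite h1 in H. lra.
- exists x1. lra.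
- exists Y. split.
  + intros t Ht. apply lub. intros u Hu. apply Rlt_le, h_lt_inv. lra.
  + intros e He. apply Rnot_le_lt. intros H. apply ub in H. lra.
Qed.

Lemma plateau_left c x1 : h x1 = c -> exists X,
  (forall t, h t < c -> t <= X) /\ forall e, 0 < e -> h (X - e) < c.
Proof.
intros Hc. destruct (completeness (fun t => h t < c)) as [X [ub lub]].
- exists x1. intros t Ht. apply Rlt_le, h_lt_inv. lra.
- exists (x1 - 1). generalize (h1 (x1 - 1)). replace (x1 - 1 + 1) with x1 by ring. lra.
- exists X. split; [exact ub |].
  intros e He. apply Rnot_le_lt. intros H. assert (X <= X - e); [| lra].
  apply lub. intros t Ht. apply Rlt_le, h_lt_inv. lra.
Qed.

Lemma h_strict x y : x < y -> h x < h y.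
Proof.
intros hxy. destruct (hmono x y) as [H | H]; [lra | trivial | exfalso].
set (c := h x) in *.
destruct (plateau_right c x eq_refl) as (Y & Y1 & Y2).
destruct (plateau_left c x eq_refl) as (X & X1 & X2).
(* Chosen so that [la * eta = (y - x) / 2]: lengths at most [eta] on both sides give
   [(y - x)^2 <= (y - x)^2 / 4]. *)
set (eta := (y - x) / (2 * la)).
assert (Heta : 0 < eta) by (apply Rdiv_lt_0_compat; lra).
specialize (Y2 eta Heta). specialize (X2 eta Heta).
destruct (closest_return al (Rmin (h (Y + eta) - c) (c - h (X - eta))) irr)
  as (q & p & hq & [d1 d2] & best).
{ apply Rmin_glb_lt; lra. }
set (de := IZR p - INR q * al) in *.
assert (D1 := Rlt_le_trans _ _ _ d2 (Rmin_l _ _)).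
assert (D2 := Rlt_le_trans _ _ _ d2 (Rmin_r _ _)).
(* The translated preimage has [h] equal to [c + de] and the translated image has [c - de]; as [de]
   is small, they lie within [eta] of the right and left ends of the plateau. *)
set (x2 := itn (Finv F) q x + IZR p). set (y2 := itn (Finv F) q y + IZR p).
assert (hx2 : h x2 = c + de).
{ unfold x2. rewrite (degree1_IZR h h1), h_itn_Finv. unfold de, c. ring. }
assert (hy2 : h y2 = c + de).
{ unfold y2. rewrite (degree1_IZR h h1), h_itn_Finv, <- H. unfold de. ring. }
assert (xy2 : x2 < y2).
{ unfold x2, y2. generalize (lift_lt _ (lift_itn _ (lift_Finv F HF) q) _ _ hxy). lra. }
assert (len2 : y2 - x2 <= eta).
{ assert (Y <= x2) by (apply Y1; lra). assert (y2 < Y + eta) by (apply h_lt_inv; lra). lra. }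
assert (lenq : itn F q y - itn F q x <= eta).
{ assert (itn F q y + IZR (- p) <= X).
  { apply X1. rewrite (degree1_IZR h h1), h_itn, opp_IZR. unfold de in d1. lra. }
  assert (X - eta < itn F q x + IZR (- p)).
  { apply h_lt_inv. rewrite (degree1_IZR h h1), h_itn, opp_IZR. fold c. unfold de in D2. lra. }
  lra. }
assert (yx2 : y < x2) by (apply h_lt_inv; lra).
generalize (distortion x y x2 y2 q de hxy yx2 xy2 hy2 best).
assert (Eq : itn F q y2 - itn F q x2 = y - x).
{ unfold x2, y2. rewrite !(lift_IZR _ (lift_itn F HF q)), !itn_Finv_r by trivial. ring. }
rewrite Eq. intros K.
assert (pq : 0 < itn F q y - itn F q x)
  by (generalize (lift_lt _ (lift_itn F HF q) _ _ hxy); lra).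
assert (E : la * eta = (y - x) / 2) by (unfold eta; field; lra).
assert (K1 : (itn F q y - itn F q x) * (y2 - x2) <= eta * eta)
  by (apply Rmult_le_compat; lra).
apply (Rmult_le_compat_l (la * la)) in K1; [| nra].
replace (la * la * (eta * eta)) with ((la * eta) * (la * eta)) in K1 by ring.
rewrite E in K1. nra.
Qed.

(** A jump of [h] would leave out an interval of values, but [h] takes all the values
    [h 0 + n al + m], which are dense. *)
Lemma h_lift : circle_lift h.
Proof.
split; [exact h_strict | exact h1 |].
intros t. destruct (completeness (fun x => h x <= t)) as [k [ub lub]].
- destruct (archimed (t - h 0)) as [u1 u2]. exists (0 + IZR (up (t - h 0))).
  intros x Hx. apply Rlt_le, h_lt_inv. rewrite (degree1_IZR h h1). lra.
- destruct (archimed (t - h 0)) as [u1 u2]. exists (0 + IZR (up (t - h 0) - 1)).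
  rewrite (degree1_IZR h h1), minus_IZR. lra.
- exists k. destruct (Rtotal_order (h k) t) as [H | [H | H]]; trivial; exfalso.
  + destruct (irrational_dense al (h k - h 0) (t - h 0) irr) as (n & m & h2 & h3); [lra |].
    assert (E : h (itn F n 0 + IZR m) = h 0 + INR n * al + IZR m)
      by now rewrite (degree1_IZR h h1), h_itn.
    assert (k < itn F n 0 + IZR m) by (apply h_lt_inv; lra).
    assert (itn F n 0 + IZR m <= k) by (apply ub; lra). lra.
  + destruct (irrational_dense al (t - h 0) (h k - h 0) irr) as (n & m & h2 & h3); [lra |].
    assert (E : h (itn F n 0 + IZR m) = h 0 + INR n * al + IZR m)
      by now rewrite (degree1_IZR h h1), h_itn.
    assert (itn F n 0 + IZR m < k) by (apply h_lt_inv; lra).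
    assert (k <= itn F n 0 + IZR m); [| lra].
    apply lub. intros x Hx. apply Rlt_le, h_lt_inv. lra.
Qed.

(** Density of the values of [h] along the orbit is pulled back by strict monotonicity; forward
    times suffice. *)
Lemma orbits_dense x y eps : 0 < eps -> exists n : Z, dT (itz F n x) y < eps.
Proof.
intros He. assert (Hy := h_strict y (y + eps) ltac:(lra)).
destruct (irrational_dense al (h y - h x) (h (y + eps) - h x) irr) as (n & k & k1 & k2);
  [lra |].
exists (Z.of_nat n).
assert (E : itz F (Z.of_nat n) x = itn F n x).
{ destruct n as [|n]; [reflexivity |]. cbn [Z.of_nat itz].
  now rewrite SuccNat2Pos.id_succ. }
rewrite E.
assert (E' : h (itn F n x + IZR k) = h x + INR n * al + IZR k)
  by now rewrite (degree1_IZR h h1), h_itn.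
assert (y < itn F n x + IZR k) by (apply h_lt_inv; lra).
assert (itn F n x + IZR k < y + eps) by (apply h_lt_inv; lra).
apply Rle_lt_trans with (1 := dT_le _ _ (- k)%Z). rewrite opp_IZR.
apply Rabs_def1; lra.
Qed.

End IrrationalRotation.

(** * The billiard map *)

Lemma Lipschitz_perturbation_lift (c : R -> R) k :
  (forall u, c (u + 1) = c u) -> 0 <= k < 1 ->
  (forall u v, u <= v -> Rabs (c v - c u) <= k * (v - u)) ->
  circle_lift (fun u => u + c u).
Proof.
intros per hk lip. split.
- intros u v h. generalize (lip u v ltac:(lra)). intros K.
  apply (proj1 (Rabs_le_between _ _)) in K. nra.
- intros u. rewrite per. ring.
- intros y.
  assert (deg := degree1_IZR (fun u => u + c u)
    ltac:(intros u; cbv beta; rewrite per; ring)). cbv beta in deg.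
  destruct (archimed (y - c 0)) as [u1 u2]. set (m := up (y - c 0)) in *.
  assert (cont : Ranalysis1.continuity (fun u => u + c u)).
  { apply Ranalysis1.continuity_plus; [apply derivable_continuous, derivable_id |].
    intros u eps He. exists eps. split; trivial. intros v [_ Hv].
    simpl in *. unfold Rdist in *. destruct (Rle_lt_dec u v) as [h | h].
    - apply Rle_lt_trans with (1 := lip u v h). rewrite Rabs_pos_eq in Hv; nra.
    - rewrite Rabs_minus_sym. apply Rle_lt_trans with (1 := lip v u ltac:(lra)).
      rewrite Rabs_left in Hv; nra. }
  assert (E1 := deg m 0). assert (E2 := deg (m - 1)%Z 0). rewrite minus_IZR in E2.
  destruct (IVT_gen (fun u => u + c u) (0 + IZR (m - 1)) (0 + IZR m) y cont)
    as [x [_ Hx]]; [| now exists x].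
  rewrite minus_IZR, E1, E2, Rmin_left, Rmax_right; lra.
Qed.

Lemma lift_ext F G : (forall x, F x = G x) -> circle_lift F -> circle_lift G.
Proof.
intros H HF; split.
- intros x y. rewrite <- !H. apply (lift_lt F HF).
- intros x. rewrite <- !H. apply (lift_1 F HF).
- intros y. destruct (lift_surj F HF y) as [x <-]. now exists x.
Qed.

Section Billiard.

Variables (b : R -> R) (dM th : R).
Hypothesis Hb : admissible b.
Hypothesis HdM : rderiv b (- / 2) dM.
Hypothesis Hth : atan dM < th < PI / 2.

Lemma profile_even x : Ih x -> b (- x) = b x.
Proof. apply Hb. Qed.

Lemma profile_concave : concave_btw b (- / 2) (/ 2).
Proof. intros x y t hx hy ht. now apply Hb. Qed.

(** Slopes of a concave function decrease to the right. A chord steeper than [dM] would therefore be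
    steeper than the short chords at the left end, whose slopes tend to [dM]. *)
Lemma profile_slope x y : - / 2 <= x -> x < y -> y <= / 2 -> b y - b x <= dM * (y - x).
Proof.
intros hx hxy hy. apply Rnot_lt_le. intros h.
set (sl := (b y - b x) / (y - x)).
assert (E : sl * (y - x) = b y - b x) by (unfold sl; field; lra).
assert (hsl : dM < sl) by nra.
destruct (HdM (sl - dM)) as [d [hd Hd]]; [lra |].
set (e := Rmin (d / 2) ((y - x) / 2)).
assert (he : 0 < e /\ e <= d / 2 /\ e <= (y - x) / 2).
{ unfold e. generalize (Rmin_l (d / 2) ((y - x) / 2)) (Rmin_r (d / 2) ((y - x) / 2))
    (Rmin_glb_lt (d / 2) ((y - x) / 2) 0). lra. }
specialize (Hd e ltac:(lra)). apply Rabs_def2 in Hd.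
set (D := (b (- / 2 + e) - b (- / 2)) / e) in *.
assert (ED : D * e = b (- / 2 + e) - b (- / 2)) by (unfold D; field; lra).
assert (K : (b y - b x) * e <= (b (- / 2 + e) - b (- / 2)) * (y - x)).
{ replace e with (- / 2 + e - - / 2) at 1 by ring.
  destruct (Rle_lt_dec (- / 2 + e) x) as [h1 | h1].
  - apply (concave_slopes_disjoint b _ _ profile_concave (- / 2) (- / 2 + e) x y); lra.
  - assert (S1 := concave_slopes b _ _ profile_concave (- / 2) (- / 2 + e) y
      ltac:(lra) ltac:(lra) ltac:(lra) ltac:(lra)).
    destruct hx as [hx | hx].
    + assert (S2 := concave_slopes b _ _ profile_concave (- / 2) x y
        ltac:(lra) ltac:(lra) ltac:(lra) ltac:(lra)).
      assert (S3 := concave_slopes b _ _ profile_concave (- / 2) x (- / 2 + e)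
        ltac:(lra) ltac:(lra) ltac:(lra) ltac:(lra)).
      assert (S4 := concave_slopes b _ _ profile_concave x (- / 2 + e) y
        ltac:(lra) ltac:(lra) ltac:(lra) ltac:(lra)).
      (* The two chords overlap here; the comparison passes through the chord over the overlap
         [[x, - / 2 + e]]. *)
      set (B := b (- / 2 + e)) in *. set (B0 := b (- / 2)) in *.
      assert (M1 : (b y - b x) * (- / 2 + e - x) <= (B - b x) * (y - x)) by lra.
      assert (M2 : (B - b x) * e <= (B - B0) * (- / 2 + e - x)) by lra.
      replace (- / 2 + e - - / 2) with e by ring.
      apply Rmult_le_reg_r with (- / 2 + e - x); [lra |].
      apply Rle_trans with ((B - b x) * (y - x) * e).
      * apply (Rmult_le_compat_r e) in M1; lra.
      * apply (Rmult_le_compat_r (y - x)) in M2; lra.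
    + subst x. lra. }
rewrite <- E, <- ED in K.
assert (sl <= D); [| lra]. apply Rmult_le_reg_r with (e * (y - x)); nra.
Qed.

Lemma wall_slope_nonneg : 0 <= dM.
Proof.
destruct Hb as (_ & ev & _ & mono & _).
generalize (profile_slope (- / 2) 0 ltac:(lra) ltac:(lra) ltac:(lra)).
rewrite (ev (/ 2)) by (unfold Ih; lra).
generalize (mono 0 (/ 2) ltac:(lra) ltac:(lra) ltac:(lra)). lra.
Qed.

Lemma profile_Lipschitz x y : - / 2 <= x -> x <= y -> y <= / 2 ->
  Rabs (b y - b x) <= dM * (y - x).
Proof.
intros hx [hxy | <-] hy.
- apply Rabs_le. generalize (profile_slope x y hx hxy hy).
  generalize (profile_slope (- y) (- x) ltac:(lra) ltac:(lra) ltac:(lra)).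
  rewrite !profile_even by (unfold Ih; lra). lra.
- rewrite !Rminus_diag, Rabs_R0. lra.
Qed.

Lemma bper_eq n x : Ih x -> bper b (x + IZR n) = b x.
Proof.
intros [h1 h2]. unfold bper, red. destruct h2 as [h2 | ->].
- rewrite <- (Int_part_spec (x + IZR n + / 2) n) by lra. f_equal. ring.
(* The right end of a cell is reduced to [- / 2], where evenness gives the same value. *)
- rewrite <- (Int_part_spec (/ 2 + IZR n + / 2) (n + 1)%Z) by (rewrite plus_IZR; lra).
  rewrite plus_IZR. replace (/ 2 + IZR n - (IZR n + 1)) with (- / 2) by field.
  apply profile_even. unfold Ih; lra.
Qed.

Lemma cell_decomposition u : exists n x, - / 2 <= x < / 2 /\ u = x + IZR n.
Proof.
destruct (archimed (u + / 2)) as [h1 h2].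
exists (up (u + / 2) - 1)%Z, (u - IZR (up (u + / 2) - 1)).
rewrite minus_IZR. split; lra.
Qed.

Lemma bper_1 u : bper b (u + 1) = bper b u.
Proof.
destruct (cell_decomposition u) as (n & x & hx & ->).
replace (x + IZR n + 1) with (x + IZR (n + 1)) by (rewrite plus_IZR; ring).
now rewrite !bper_eq by (unfold Ih; lra).
Qed.

Lemma bper_Lipschitz u v : u <= v -> Rabs (bper b v - bper b u) <= dM * (v - u).
Proof.
intros h. destruct (cell_decomposition u) as (n & x & hx & ->).
destruct (cell_decomposition v) as (m & y & hy & ->).
rewrite !bper_eq by (unfold Ih; lra).
destruct (Z.lt_trichotomy n m) as [hn | [<- | hn]].
(* In different cells the estimate goes through the common value of [b] at the walls: [v - u] is at
   least [(/ 2 - x) + (y + / 2)]. *)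
- assert (hn' : (n + 1 <= m)%Z) by lia. apply IZR_le in hn'. rewrite plus_IZR in hn'.
  generalize (profile_Lipschitz x (/ 2) ltac:(lra) ltac:(lra) ltac:(lra)).
  generalize (profile_Lipschitz (- / 2) y ltac:(lra) ltac:(lra) ltac:(lra)).
  rewrite (profile_even (/ 2)) by (unfold Ih; lra). intros K1 K2.
  apply (proj1 (Rabs_le_between _ _)) in K1, K2. apply Rabs_le.
  generalize wall_slope_nonneg. intros d0. nra.
- replace (y + IZR n - (x + IZR n)) with (y - x) by ring.
  apply profile_Lipschitz; lra.
- assert (hn' : (m + 1 <= n)%Z) by lia. apply IZR_le in hn'. rewrite plus_IZR in hn'. lra.
Qed.

Lemma tan_gt_wall_slope : dM < tan th.
Proof.
rewrite <- (tan_atan dM). apply tan_increasing; try lra. generalize (atan_bound dM). lra.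
Qed.

Lemma scaled_bper_Lipschitz u v : u <= v ->
  Rabs (bper b v / tan th - bper b u / tan th) <= dM / tan th * (v - u).
Proof.
intros h. generalize tan_gt_wall_slope wall_slope_nonneg. intros t1 t2.
replace (bper b v / tan th - bper b u / tan th) with ((bper b v - bper b u) * / tan th)
  by (field; lra).
rewrite Rabs_mult, (Rabs_pos_eq (/ tan th)) by (left; apply Rinv_0_lt_compat; lra).
replace (dM / tan th * (v - u)) with (dM * (v - u) * / tan th) by (field; lra).
apply Rmult_le_compat_r; [left; apply Rinv_0_lt_compat; lra | now apply bper_Lipschitz].
Qed.

Lemma slope_ratio_bounds : 0 <= dM / tan th < 1.
Proof.
generalize tan_gt_wall_slope wall_slope_nonneg. intros t1 t2. split.
- apply Rdiv_le_0_compat; lra.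
- apply Rmult_lt_reg_r with (tan th); [lra |].
  replace (dM / tan th * tan th) with dM by (field; lra). lra.
Qed.

(* A trajectory leaving the section at [departure u] hits the boundary at
   abscissa [u] and comes back to the section at [arrival u]. *)
Definition departure (u : R) : R := u + - (bper b u / tan th).
Definition arrival (u : R) : R := u + bper b u / tan th.

Lemma departure_lift : circle_lift departure.
Proof.
apply (Lipschitz_perturbation_lift (fun u => - (bper b u / tan th)) (dM / tan th)).
- intros u. now rewrite bper_1.
- apply slope_ratio_bounds.
- intros u v h. rewrite <- Rabs_Ropp.
  replace (- (- (bper b v / tan th) - - (bper b u / tan th)))
    with (bper b v / tan th - bper b u / tan th) by ring.
  now apply scaled_bper_Lipschitz.
Qed.

Lemma arrival_lift : circle_lift arrival.
Proof.
apply (Lipschitz_perturbation_lift (fun u => bper b u / tan th) (dM / tan th)).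
- intros u. now rewrite bper_1.
- apply slope_ratio_bounds.
- exact scaled_bper_Lipschitz.
Qed.

(** Surjectivity of [departure] makes the equation defining [hit] solvable, so that [epsilon]
    returns a genuine solution. *)
Lemma departure_hit x : departure (hit b th x) = x.
Proof.
assert (t1 := tan_gt_wall_slope). assert (t2 := wall_slope_nonneg).
assert (S : (hit b th x - x) * tan th = bper b (hit b th x)).
{ unfold hit. apply epsilon_spec.
  destruct (lift_surj _ departure_lift x) as [u Hu]. exists u.
  rewrite <- Hu. unfold departure. field. lra. }
unfold departure. rewrite <- S. field. lra.
Qed.

Lemma retF_arrival x : retF b th x = arrival (hit b th x).
Proof.
unfold retF. rewrite <- (departure_hit x) at 2. unfold departure, arrival. ring.
Qed.

Lemma hit_lift : circle_lift (hit b th).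
Proof.
apply (lift_ext (Finv departure)); [| apply lift_Finv, departure_lift].
intros x. apply (lift_inj _ departure_lift).
now rewrite departure_hit, (lift_Finv_r _ departure_lift).
Qed.

Lemma retF_lift : circle_lift (retF b th).
Proof.
apply (lift_ext (fun x => arrival (hit b th x))).
- intros x. symmetry. apply retF_arrival.
- apply lift_comp; [apply arrival_lift | apply hit_lift].
Qed.

(** This makes the rotation number of the lift nonnegative, so that its numerator over [q] is a
    natural number. *)
Lemma retF_ge x : x <= retF b th x.
Proof.
assert (t1 := tan_gt_wall_slope). assert (t2 := wall_slope_nonneg).
rewrite retF_arrival, <- (departure_hit x) at 1. unfold departure, arrival.
set (u := hit b th x). destruct (cell_decomposition u) as (n & y & hy & ->).
rewrite bper_eq by (unfold Ih; lra).
assert (0 <= b y) by (apply Hb; unfold Ih; lra).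
assert (0 <= b y / tan th) by (apply Rdiv_le_0_compat; lra). lra.
Qed.

(** If [d] is the distance between the two hitting abscissas, the distances at departure and at
    arrival both lie between [(1 - k) d] and [(1 + k) d]. *)
Lemma retF_bilipschitz : exists la, 1 <= la /\
  (forall x y, x < y -> retF b th y - retF b th x <= la * (y - x)) /\
  (forall x y, x < y -> y - x <= la * (retF b th y - retF b th x)).
Proof.
assert (K := slope_ratio_bounds). set (k := dM / tan th) in *.
set (la := (1 + k) / (1 - k)).
assert (E : la * (1 - k) = 1 + k) by (unfold la; field; lra).
assert (la1 : 1 <= la) by (apply Rmult_le_reg_r with (1 - k); lra).
assert (B : forall x y, x < y -> exists d, 0 < d /\
  (1 - k) * d <= y - x <= (1 + k) * d /\
  (1 - k) * d <= retF b th y - retF b th x <= (1 + k) * d).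
{ intros x y h. assert (hh := lift_lt _ hit_lift _ _ h).
  exists (hit b th y - hit b th x). split; [lra |].
  rewrite !retF_arrival. generalize (departure_hit x) (departure_hit y). intros dx dy.
  generalize (scaled_bper_Lipschitz _ _ (Rlt_le _ _ hh)). intros L. fold k in L.
  apply (proj1 (Rabs_le_between _ _)) in L. unfold departure in dx, dy. unfold arrival. lra. }
exists la. split; trivial. split; intros x y h;
  destruct (B x y h) as (d & hd & [c1 c2] & [c3 c4]).
- apply Rle_trans with (1 := c4). rewrite <- E, Rmult_assoc.
  apply Rmult_le_compat_l; lra.
- apply Rle_trans with (1 := c2). rewrite <- E, Rmult_assoc.
  apply Rmult_le_compat_l; lra.
Qed.

Lemma hit_cell x : departure (- / 2) <= x <= departure (- / 2) + 1 -> Ih (hit b th x).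
Proof.
rewrite <- (lift_1 _ departure_lift). rewrite <- (departure_hit x). intros [h1 h2].
apply (lift_le_inv _ departure_lift) in h1, h2. rewrite departure_hit in *.
unfold Ih. lra.
Qed.

Lemma departure_cell u : Ih u -> departure u = u - b u / tan th.
Proof.
intros h. unfold departure. generalize (bper_eq 0 u h). rewrite Rplus_0_r.
intros ->. ring.
Qed.

(* [departure] is convex on a cell, so its inverse [hit] is concave. *)
Lemma retF_concave :
  concave_btw (retF b th) (departure (- / 2)) (departure (- / 2) + 1).
Proof.
assert (t1 := tan_gt_wall_slope). assert (t2 := wall_slope_nonneg).
intros x y t hx hy ht. unfold retF.
assert (kx := hit_cell x hx). assert (ky := hit_cell y hy).
set (w := t * hit b th x + (1 - t) * hit b th y).
assert (hw : Ih w) by (apply convex_comb_bounds; trivial).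
(* As [retF] is twice [hit] minus the identity, concavity of [hit] is enough. *)
assert (K : w <= hit b th (t * x + (1 - t) * y)); [| unfold w in K; lra].
apply (lift_le_inv _ departure_lift). rewrite departure_hit.
rewrite <- (departure_hit x) at 1. rewrite <- (departure_hit y) at 1.
rewrite !departure_cell by trivial.
assert (C := profile_concave _ _ t kx ky ht). fold w in C.
apply Rmult_le_compat_r with (r := / tan th) in C;
  [| left; apply Rinv_0_lt_compat; lra].
unfold Rdiv. unfold w at 1. lra.
Qed.

Lemma retF_strictly_concave : strictly_concave_on b ->
  strictly_concave_btw (retF b th) (departure (- / 2)) (departure (- / 2) + 1).
Proof.
assert (t1 := tan_gt_wall_slope). assert (t2 := wall_slope_nonneg).
intros Hs x y t hx hy hxy ht. unfold retF.
assert (kx := hit_cell x hx). assert (ky := hit_cell y hy).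
set (w := t * hit b th x + (1 - t) * hit b th y).
assert (hw : Ih w) by (apply convex_comb_bounds; trivial; lra).
assert (K : w < hit b th (t * x + (1 - t) * y)); [| unfold w in K; lra].
apply (lift_lt_inv _ departure_lift). rewrite departure_hit.
rewrite <- (departure_hit x) at 1. rewrite <- (departure_hit y) at 1.
rewrite !departure_cell by trivial.
assert (ne : hit b th x <> hit b th y).
{ intros E. apply hxy. now apply (lift_inj _ hit_lift). }
assert (C := Hs _ _ t kx ky ne ht). fold w in C.
apply Rmult_lt_compat_r with (r := / tan th) in C; [| apply Rinv_0_lt_compat; lra].
unfold Rdiv. unfold w at 1. lra.
Qed.

End Billiard.

(** * Arithmetic of the rotation number, and the theorem *)

Lemma irrational_of_frac al :
  (forall p q : nat, (0 < q)%nat -> frac_part al <> INR p / INR q) -> irrational al.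
Proof.
intros H n m hn E. apply (H (Z.to_nat (m - Z.of_nat n * Int_part al)) n hn).
assert (hn' : 0 < INR n) by now apply lt_0_INR.
assert (E' : INR n * frac_part al = IZR (m - Z.of_nat n * Int_part al)).
{ rewrite minus_IZR, mult_IZR, <- INR_IZR_INZ, <- E. unfold frac_part. ring. }
rewrite INR_IZR_INZ, Z2Nat.id.
- rewrite <- E'. field. lra.
- apply le_IZR. rewrite <- E'. generalize (frac_part_bounds al). nra.
Qed.

(** The coefficient [r] counts iterates and must be natural, so it is reduced modulo [q]; the signed
    [s] absorbs this change and the shift by [q M]. *)
Lemma bezout_shift p q M : Nat.gcd p q = 1%nat -> (0 < q)%nat ->
  exists (r : nat) (s : Z),
    (Z.of_nat r * Z.of_nat (p + q * M) + s * Z.of_nat q = 1)%Z.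
Proof.
intros Hg Hq.
destruct (Nat.gcd_bezout_pos q p Hq) as (v & u' & E'). rewrite Nat.gcd_comm, Hg in E'.
assert (E : (- Z.of_nat u' * Z.of_nat p + Z.of_nat v * Z.of_nat q = 1)%Z) by lia.
set (u := (- Z.of_nat u')%Z) in *.
set (Q := Z.of_nat q) in *. assert (HQ : (0 < Q)%Z) by lia.
exists (Z.to_nat (u mod Q)), (Z.of_nat v + Z.of_nat p * (u / Q) - (u mod Q) * Z.of_nat M)%Z.
rewrite Z2Nat.id by (apply Z.mod_pos_bound; lia).
rewrite Nat2Z.inj_add, Nat2Z.inj_mul. fold Q.
rewrite Z.mod_eq by lia. rewrite <- E. ring.
Qed.

Theorem theorem2p2 (b : R -> R) (dM th : R) :
  admissible b -> rderiv b (- / 2) dM -> atan dM < th < PI / 2 ->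
  let F := retF b th in
  let rho := rotnum F in
  (* (i) irrational rotation number *)
  ((forall p q : nat, (0 < q)%nat -> rho <> INR p / INR q) ->
     (exists h : R -> R, Thomeo h /\ forall x, eqm (h (F x)) (h x + rho)) /\
     (forall x y eps, 0 < eps -> exists n : Z, dT (itz F n x) y < eps)) /\
  (* (ii) rational rotation number p/q *)
  (forall p q : nat, (0 < q)%nat -> Nat.gcd p q = 1%nat -> rho = INR p / INR q ->
     exists am cm ap cp : nat -> R,
       (* P_i^- = [am i, cm i], P_i^+ = [ap i, cp i] closed arcs *)
       (forall i, (i < q)%nat ->
          am i <= cm i <= am i + 1 /\ ap i <= cp i <= ap i + 1) /\
       (forall i x, (i < q)%nat ->
          (inArc (am i) (cm i) x \/ inArc (ap i) (cp i) x) -> eqm (itn F q x) x) /\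
       (forall i n y, (i < q)%nat ->
          (inArc (am ((i + p * n) mod q)%nat) (cm ((i + p * n) mod q)%nat) y <->
             exists x, inArc (am i) (cm i) x /\ eqm (itn F n x) y) /\
          (inArc (ap ((i + p * n) mod q)%nat) (cp ((i + p * n) mod q)%nat) y <->
             exists x, inArc (ap i) (cp i) x /\ eqm (itn F n x) y)) /\
       (forall x, (forall i, (i < q)%nat ->
                     ~ inArc (am i) (cm i) x /\ ~ inArc (ap i) (cp i) x) ->
          forall n, (0 < n)%nat -> ~ eqm (itn F n x) x) /\
       (caseA F p q am cm ap cp \/ caseB F p q am cm ap cp) /\
       (strictly_concave_on b -> caseA F p q am cm ap cp)).
Proof.
intros Hb HdM Hth F rho.
assert (HF : circle_lift F) by now apply (retF_lift b dM).
destruct (rotation_exists F HF) as [al Hal].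
assert (Hrho : rho = frac_part al) by now apply rotnum_frac.
assert (conc := retF_concave b dM th Hb HdM Hth).
split.
- intros H. assert (irr : irrational al).
  { apply irrational_of_frac. intros p q hq. rewrite <- Hrho. now apply H. }
  destruct (retF_bilipschitz b dM th Hb HdM Hth) as (la & la1 & lip & lip').
  destruct (semiconjugacy F al HF Hal) as (h & hm & h1 & hF).
  split.
  + exists h. split.
    * apply lift_Thomeo. now apply (h_lift F h (departure b th (- / 2)) la al).
    * intros x. exists (Int_part al). rewrite hF, Hrho. unfold frac_part. ring.
  + now apply (orbits_dense F h (departure b th (- / 2)) la al).
- intros p q Hq Hg Hpq.
  assert (al0 : 0 <= al).
  { generalize (rotation_ge F al 1 0 0 HF Hal). simpl.
    generalize (retF_ge b dM th Hb HdM Hth 0). fold F. lra. }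
  assert (I0 : (0 <= Int_part al)%Z).
  { destruct (base_Int_part al) as [i1 i2].
    assert (-1 < Int_part al)%Z by (apply lt_IZR; lra). lia. }
  (* The lift makes [M] extra full turns per iterate, so its rotation number is [(p + q M) / q]. *)
  set (M := Z.to_nat (Int_part al)).
  assert (HP : INR q * al = INR (p + q * M)).
  { replace al with (IZR (Int_part al) + frac_part al) by (unfold frac_part; ring).
    rewrite <- Hrho, Hpq, plus_INR, mult_INR. unfold M.
    rewrite (INR_IZR_INZ (Z.to_nat _)), Z2Nat.id by trivial. field.
    apply not_0_INR. lia. }
  destruct (bezout_shift p q M Hg Hq) as (r & s & bez).
  apply (rational_rotation_picture F p (p + q * M) q r s (departure b th (- / 2)) al);
    trivial.
  + rewrite Nat.mul_comm. apply Nat.Div0.mod_add.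
  + now apply (retF_strictly_concave b dM).
Qed.
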